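(* Let $X=[0,1]$, let $\alpha\ge 0$ and let $T_\alpha:X\to X$, $T_\alpha x := x+x^{1+\alpha} \pmod 1$. Fix $K<\infty$ and consider finite partitions $\Delta=\{\Delta_i\}$ of $X$ into (not necessarily equal) intervals satisfying $m(\Delta_i)/m(\Delta_j)\le K$ for all $i,j$; let $\delta$ denote the diameter of $\Delta$ and let $\Delta_1\in\Delta$ be the interval containing the origin. Then for all small enough $\delta>0$ (how small may depend on $\alpha$ and $K$) the Markov chain generated by the operator $Q_\Delta^* T_\alpha^*$ is uniquely ergodic, and its unique invariant distribution $\mu_\Delta$ satisfies: (a) for every $\alpha\ge 0$, $\mu_\Delta(\Delta_1)\le C\,\delta^{1-\alpha}$, where $C<\infty$ is a constant not depending on $\Delta$ (it may depend on $\alpha$ and $K$); (b) for every $\alpha>0$, $\mu_\Delta(\Delta_1)/\delta\to\infty$ as $\delta\to0$; (c) for every $\alpha>1$, $\mu_\Delta\to D_0$ weakly as $\delta\to0$, where $D_0$ is the Dirac measure at the origin. (The limits $\delta\to0$ are along finite partitions $\Delta=\{\Delta_i\}$ of $X$ into intervals satisfying $m(\Delta_i)/m(\Delta_j)\le K$ for all $i,j$, with $K$ and $\alpha$ fixed.)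
   Context: $m$ is Lebesgue measure on $X=[0,1]$. For a measurable map $T:X\to X$ and a probability measure $\mu$ on $X$, the transfer operator is $T^*\mu(A):=\mu(T^{-1}A)$ for Borel sets $A\subseteq X$. For a finite partition $\Delta=\{\Delta_i\}$ of $X$ into intervals of positive length, $$Q_\Delta^*\mu(A):=\sum_i\frac{m(A\cap\Delta_i)}{m(\Delta_i)}\,\mu(\Delta_i).$$ The diameter of $\Delta$ is $\delta:=\max_i m(\Delta_i)$. The Markov chain generated by $Q_\Delta^*T^*$ is the finite state chain (with states the indices $i$) with transition probabilities $p_{i,j}=m(\Delta_i\cap T^{-1}\Delta_j)/m(\Delta_i)$. A Markov chain is uniquely ergodic if it has a unique stationary probability distribution. If $\pi=(\pi_i)$ is this stationary distribution ($\sum_i\pi_i=1$, $\sum_i \pi_i p_{i,k}=\pi_k$ for all $k$), it is identified with the probability measure $\mu_\Delta(A)=\sum_i\pi_i\, m(A\cap\Delta_i)/m(\Delta_i)$ on $X$; in particular $\mu_\Delta(\Delta_i)=\pi_i$ and $Q_\Delta^*T^*\mu_\Delta=\mu_\Delta$. *)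

(* Defs.v *)
From HB Require Import structures.
From mathcomp Require Import all_boot all_order all_algebra.
From mathcomp Require Import all_classical all_reals all_analysis.

Set Implicit Arguments.
Unset Strict Implicit.
Unset Printing Implicit Defensive.

Import Order.TTheory GRing.Theory Num.Theory.
Import numFieldNormedType.Exports.

Local Open Scope classical_set_scope.
Local Open Scope ring_scope.

Record distr (R : realType) (n : nat) := Distr {
  weight :> {ffun 'I_n -> R};
  distrP : [forall i, 0 <= weight i] && (\sum_i weight i == 1) }.

HB.instance Definition _ (R : realType) n := [isSub for @weight R n].
HB.instance Definition _ (R : realType) n := [Choice of distr R n by <:].

Section FiniteChains.
Context {R : realType}.

Lemma distr_ge0 n (pi : distr R n) i : 0 <= pi i.
Proof. by case/andP: (distrP pi) => /forallP. Qed.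

Lemma distr_sum n (pi : distr R n) : \sum_i pi i = 1.
Proof. by case/andP: (distrP pi) => _ /eqP. Qed.

Fact uniform_distr_proof n (w := [ffun=> n.+1%:R^-1] : {ffun 'I_n.+1 -> R}) :
  [forall i, 0 <= w i] && (\sum_i w i == 1).
Proof.
apply/andP; split; first by apply/forallP => i; rewrite ffunE invr_ge0.
under eq_bigr do rewrite ffunE.
by rewrite sumr_const card_ord -[_ *+ _]mulr_natl divff ?pnatr_eq0.
Qed.
Definition uniform_distr n : distr R n.+1 := Distr (uniform_distr_proof n).

Definition stationary n (P : 'M[R]_n) (pi : distr R n) : Prop :=
  forall k, \sum_i pi i * P i k = pi k.

Definition uniquely_ergodic n (P : 'M[R]_n) : Prop :=
  exists! pi : distr R n, stationary P pi.

(* The uniform distribution is a junk value, returned only when P has no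
   stationary distribution. *)
Definition invariant_distr n (P : 'M[R]_n.+1) : distr R n.+1 :=
  xget (uniform_distr n) [set pi | stationary P pi].

Lemma invariant_distrP n (P : 'M[R]_n.+1) (pi : distr R n.+1) :
  uniquely_ergodic P -> stationary P pi <-> pi = invariant_distr P.
Proof.
move=> [rho [Prho uniq]]; rewrite /invariant_distr.
have <- : rho = xget (uniform_distr n) [set pi | stationary P pi].
  by apply: uniq; apply: xgetPex; exists rho.
by split=> [/uniq|->].
Qed.

End FiniteChains.

(* The number of cells is ncells.+1, as a partition of [0, 1] is never empty. *)
Record cell_partition (R : realType) := Partition {
  ncells : nat;
  cell : 'I_ncells.+1 -> interval R;
  cell_cover : \bigcup_i [set` cell i] = [set` `[0, 1]];
  cell_disj : trivIset setT (fun i => [set` cell i]);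
  cell_pos : forall i, (0 < lebesgue_measure [set` cell i])%E }.
Arguments cell {R} _ _.

Definition len (R : realType) (D : cell_partition R) (i : 'I_(ncells D).+1) : R :=
  fine (lebesgue_measure [set` cell D i]).
Arguments len {R} D i.

Section Partitions.
Context {R : realType}.
Implicit Type D : cell_partition R.

Definition diam D : R := \big[Num.max/0]_i len D i.

Definition balanced (K : R) D : Prop := forall i j, len D i / len D j <= K.

Definition origin_cell D : 'I_(ncells D).+1 :=
  odflt ord0 [pick i | 0 \in cell D i].

(* The filter of "diameter tends to 0" along K-balanced partitions. *)
Definition fine_partitions (K : R) : set_system (cell_partition R) :=
  filter_from [set d : R | 0 < d] (fun d => [set D | balanced K D /\ diam D < d]).

Lemma cell_sub01 D i : [set` cell D i] `<=` [set` `[0, 1]].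
Proof. by rewrite -(cell_cover D) => x Dix; exists i. Qed.

Lemma origin_cellP D : 0 \in cell D (origin_cell D).
Proof.
rewrite /origin_cell; case: pickP => //= none.
have : [set` `[0, 1]] (0 : R) by rewrite /= in_itv/= lexx ler01.
by rewrite -(cell_cover D) => -[i _ /=]; rewrite none.
Qed.

Lemma cell_disjI D i k : i != k ->
  [set` cell D k] `&` [set` cell D i] = set0.
Proof.
move=> ik; apply: contrapT => /eqP/set0P h; move/eqP: ik; apply.
by apply: (@cell_disj _ D i k) => //; rewrite setIC.
Qed.

Lemma cell_fin D i : lebesgue_measure [set` cell D i] \is a fin_num.
Proof.
rewrite ge0_fin_numE// (@le_lt_trans _ _ (lebesgue_measure `[(0 : R), 1]))//.
  by rewrite le_measure ?inE//; exact: cell_sub01.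
by rewrite lebesgue_measure_itv/= lte_fin ltr01 -EFinD ltry.
Qed.

Lemma len_gt0 D i : 0 < len D i.
Proof.
by rewrite -lte_fin fineK ?cell_fin//; exact: cell_pos.
Qed.

Global Instance fine_partitions_filter K : Filter (fine_partitions K).
Proof.
apply: filter_from_filter; first by exists 1; exact: ltr01.
move=> d e /= d0 e0; exists (Num.min d e); first by rewrite /= lt_min d0.
by move=> D /= [bD]; rewrite lt_min => /andP[].
Qed.

(* T : R -> R stands for a self-map of X = [0, 1]: the preimage is taken in R,
   but only its trace on cells, hence on X, matters. *)
Definition trans_mx (T : R -> R) D : 'M[R]_((ncells D).+1) :=
  \matrix_(i, j) (fine (lebesgue_measure
    ([set` cell D i] `&` T @^-1` [set` cell D j])) / len D i).

(* Measures on X = [0, 1] are represented as measures on R carried by X. *)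
Section CellMeasure.
Variables (D : cell_partition R) (pi : distr R (ncells D).+1).

Definition cell_measure (A : set (measurableTypeR R)) : \bar R :=
  (\sum_i (pi i / len D i)%:E * lebesgue_measure (A `&` [set` cell D i]))%E.

Let weight_ge0 i : 0 <= pi i / len D i.
Proof. by rewrite divr_ge0 ?distr_ge0// ltW// len_gt0. Qed.

Let cell_measure0 : cell_measure set0 = 0%E.
Proof.
by rewrite /cell_measure big1// => i _; rewrite set0I measure0 mule0.
Qed.

Let cell_measure_ge0 A : (0 <= cell_measure A)%E.
Proof. by apply: sume_ge0 => i _; rewrite mule_ge0// lee_fin. Qed.

Let cell_measure_sigma_additive : semi_sigma_additive cell_measure.
Proof.
move=> F mF tF mUF.
have mc i : measurable ([set` cell D i] : set (measurableTypeR R)).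
  exact: measurable_itv.
have -> : (fun n => \sum_(0 <= k < n) cell_measure (F k))%E =
    (fun n => \sum_i \sum_(0 <= k < n)
       (pi i / len D i)%:E * mrestr lebesgue_measure (mc i) (F k))%E.
  by apply/funext => n; rewrite exchange_big.
apply: cvg_nnesum => [i _|i _].
  by near=> n; apply: sume_ge0 => k _; rewrite mule_ge0// lee_fin.
under eq_fun do rewrite -ge0_sume_distrr//.
apply: cvgeZl => //.
exact: measure_semi_sigma_additive.
Unshelve. all: by end_near. Qed.

HB.instance Definition _ := isMeasure.Build _ _ _ cell_measure
  cell_measure0 cell_measure_ge0 cell_measure_sigma_additive.

Let cell_measureT : cell_measure setT = 1%E.
Proof.
rewrite /cell_measure.
under eq_bigr => i _.
  rewrite setTI -[lebesgue_measure _]fineK ?cell_fin// -EFinM divfK; last first.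
    by rewrite gt_eqF// len_gt0.
  over.
by rewrite sumEFin distr_sum.
Qed.

HB.instance Definition _ :=
  Measure_isProbability.Build _ _ _ cell_measure cell_measureT.

Lemma cell_measure_cell k : cell_measure [set` cell D k] = (pi k)%:E.
Proof.
rewrite /cell_measure (bigD1 k)//= big1 ?adde0 => [|i ik].
  rewrite setIid -[lebesgue_measure _]fineK ?cell_fin// -EFinM divfK//.
  by rewrite gt_eqF// len_gt0.
by rewrite cell_disjI// measure0 mule0.
Qed.

End CellMeasure.

Definition averaging D (mu : set R -> \bar R) (A : set R) : \bar R :=
  (\sum_i lebesgue_measure (A `&` [set` cell D i]) * (len D i)^-1%:E *
          mu [set` cell D i])%E.

Lemma averaging_cell D mu k :
  averaging D mu [set` cell D k] = mu [set` cell D k].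
Proof.
rewrite /averaging (bigD1 k)//= big1 ?adde0 => [|i ik].
  rewrite setIid -[lebesgue_measure _]fineK ?cell_fin// -EFinM mulfV ?mul1e//.
  by rewrite gt_eqF// len_gt0.
by rewrite cell_disjI// measure0 !mul0e.
Qed.

(* The chain with matrix trans_mx T D is the one generated by the operator
   Q_D^* T^*, written here averaging D (pushforward _ T). *)
Lemma stationary_averagingP (T : R -> R) D (pi : distr R (ncells D).+1) :
  stationary (trans_mx T D) pi <->
  forall A, averaging D (pushforward (cell_measure pi) T) A = cell_measure pi A.
Proof.
have pushE k : pushforward (cell_measure pi) T [set` cell D k] =
    (\sum_i pi i * trans_mx T D i k)%:E.
  rewrite /pushforward /cell_measure -sumEFin; apply: eq_bigr => i _.
  rewrite mxE setIC -[lebesgue_measure _]fineK; last first.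
    rewrite ge0_fin_numE//.
    apply: (@le_lt_trans _ _ (lebesgue_measure [set` cell D i])).
      by apply: le_outer_measure => x [].
    by rewrite -ge0_fin_numE ?cell_fin.
  by rewrite -EFinM mulrA mulrAC.
split=> [st A|inv k]; last first.
  by apply: EFin_inj; rewrite -pushE -averaging_cell inv cell_measure_cell.
apply: eq_bigr => k _; rewrite pushE st -muleA -EFinM muleC.
by rewrite [_^-1 * _]mulrC.
Qed.

End Partitions.

(* The value 0 at x = 1 is the representative of 2 mod 1. *)
Definition Tmap (R : realType) (alpha : R) (x : R) : R :=
  let y := x + x `^ (1 + alpha) in y - (Num.floor y)%:~R.

Definition invariant_measure (R : realType) (T : R -> R) (D : cell_partition R) :
    probability (measurableTypeR R) R :=
  cell_measure (invariant_distr (trans_mx T D)).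

(* For mu i and nu carried by X = [0, 1]: the test functions are those continuous
   on X, their values outside X being irrelevant. *)
Definition weak_cvg (R : realType) (I : Type) (F : set_system I)
    (mu : I -> probability (measurableTypeR R) R)
    (nu : probability (measurableTypeR R) R) : Prop :=
  forall f : R -> R, {within [set` `[0, 1]], continuous f} ->
    (\int[mu i]_(x in [set` `[0%R, 1%R]]) (f x)%:E)%E @[i --> F] -->
    (\int[nu]_(x in [set` `[0%R, 1%R]]) (f x)%:E)%E.

(* Main.v *)
(* On the sorted nodes 0 = t 0 < ... < t N = 1 an invariant law is determined by
   its distribution function F, and invariance says that mass is conserved on
   each [0, t k]: F (t k) = F (g (t k)) + F (g (1 + t k)) - F c, where g inverts
   x |-> x + x^(1+alpha) and c = g 1 is the discontinuity of T.
   Both branches of T are increasing, convex and onto, so the transfer operator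
   and the averaging preserve decreasing densities: the invariant law has a
   concave F.  It is unique because an interval charged everywhere by an
   invariant law has an image charged everywhere, and images grow until they
   reach c, hence the origin.
   With a = t 1 and m = F a, conservation on [0, a] reads
   m (a - g a) / a = F (g (1 + a)) - F c.  By concavity the right-hand side is at
   most a / c, which is (a), and at least a (1 - F c), so that
   1 - F c <= m a^(alpha - 1).  Conservation on [0, t] for a node t close to a
   fixed x then gives 1 - F x <= C_x m a^(alpha - 1), whence (b) and (c). *)
Require Import Defs.
From mathcomp Require Import all_boot all_order all_algebra.
From mathcomp Require Import all_classical all_reals all_analysis.
From mathcomp Require Import measurable_realfun ring lra.

Set Implicit Arguments.
Unset Strict Implicit.
Unset Printing Implicit Defensive.

Import Order.TTheory GRing.Theory Num.Theory.
Import numFieldNormedType.Exports.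

Local Open Scope classical_set_scope.
Local Open Scope ring_scope.

(** * Invariant vectors of finite stochastic matrices *)

Section StochasticMatrices.
Context {R : realType} {n : nat}.
Implicit Types (M : 'M[R]_n) (v : 'I_n -> R).

Definition stochastic M :=
  (forall i j, 0 <= M i j) /\ (forall i, \sum_j M i j = 1).

Definition invariant M v := forall k, \sum_i v i * M i k = v k.

Lemma stochastic_sum M v : stochastic M ->
  \sum_k \sum_i v i * M i k = \sum_i v i.
Proof.
move=> [_ M1]; rewrite exchange_big /=; apply: eq_bigr => i _.
by rewrite -mulr_sumr M1 mulr1.
Qed.

(** The triangle inequality gives [|v i| <= \sum_j |v j| * M j i]. Both sides have the same sum over
    [i], since the rows of [M] sum to 1, so equality holds term by term. *)
Lemma invariant_norm M v : stochastic M -> invariant M v ->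
  invariant M (fun i => `|v i|).
Proof.
move=> sM iv k.
have le i : `|v i| <= \sum_j `|v j| * M j i.
  rewrite -{1}(iv i); apply: le_trans (ler_norm_sum _ _ _) _.
  by apply: ler_sum => j _; rewrite normrM (ger0_norm (sM.1 _ _)).
have e0 : \sum_i (\sum_j `|v j| * M j i - `|v i|) = 0.
  by rewrite sumrB stochastic_sum// subrr.
apply/eqP; rewrite -subr_eq0; apply/eqP; apply: (psumr_eq0P _ e0) => // i _.
by rewrite subr_ge0.
Qed.

(** [M - 1%:M] annihilates the constant column, so it is singular and has a nonzero left null
    vector, whose absolute value is again invariant. *)
Lemma stochastic_invariant_ex M : stochastic M -> (0 < n)%N ->
  exists v, [/\ forall i, 0 <= v i, \sum_i v i = 1 & invariant M v].
Proof.
move=> sM n0; have := sM => -[_ M1].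
have : \det (M - 1%:M) == 0.
  rewrite -det_tr; apply/det0P; exists (const_mx 1).
    apply/eqP => /rowP /(_ (Ordinal n0)); rewrite !mxE => /eqP.
    by rewrite oner_eq0.
  apply/rowP => i; rewrite !mxE.
  under eq_bigr do rewrite !mxE mul1r.
  rewrite sumrB M1 (bigD1 i)//= eqxx big1 ?addr0 ?subrr// => j ji.
  by rewrite eq_sym (negPf ji).
move=> /det0P[u u0]; rewrite mulmxBr mulmx1 => /eqP; rewrite subr_eq0 => /eqP uM.
have iu : invariant M (u 0) by move=> k; rewrite -[in RHS]uM mxE.
have ia := invariant_norm sM iu.
pose s := \sum_i `|u 0 i|.
have s0 : 0 < s.
  rewrite lt_neqAle sumr_ge0 ?andbT//; apply/eqP => /esym/psumr_eq0P => h.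
  case/eqP: u0; apply/rowP => i; rewrite mxE; apply/eqP.
  by rewrite -normr_eq0 h.
exists (fun i => `|u 0 i| / s); split => [i||k].
- by rewrite divr_ge0// ltW.
- by rewrite -mulr_suml divff// gt_eqF.
- by rewrite -(ia k) mulr_suml; apply: eq_bigr => i _; rewrite mulrAC.
Qed.

(** For the difference [d], both [|d| + d] and [|d| - d] are nonnegative and invariant, and one of
    them vanishes at [s], hence everywhere. So [d] has constant sign and total 0. *)
Lemma stochastic_invariant_uniq M (s : 'I_n) : stochastic M ->
  (forall v, (forall i, 0 <= v i) -> invariant M v -> v s = 0 ->
     forall i, v i = 0) ->
  forall v w, invariant M v -> invariant M w -> \sum_i v i = \sum_i w i ->
  forall i, v i = w i.
Proof.
move=> sM s_charged v w iv iw vw.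
pose d i := v i - w i.
have id : invariant M d.
  move=> k; rewrite /d -iv -iw -sumrB.
  by apply: eq_bigr => i _; rewrite mulrBl.
have ia := invariant_norm sM id.
have d0 : \sum_i d i = 0 by rewrite sumrB vw subrr.
have part (e : R) : invariant M (fun i => `|d i| + e * d i).
  move=> k; rewrite -(ia k) -(id k) mulr_sumr -big_split/=.
  by apply: eq_bigr => i _; rewrite mulrDl mulrA.
suff h (e : R) : e = 1 \/ e = -1 -> `|d s| + e * d s = 0 -> forall i, d i = 0.
  move=> i; apply/eqP; rewrite -subr_eq0; apply/eqP.
  case: (lerP 0 (d s)) => ds; last by apply: (h 1); [left|rewrite ltr0_norm//; ring].
  by apply: (h (-1)); [right|rewrite ger0_norm//; ring].
move=> e1 es.
have h : forall i, `|d i| + e * d i = 0.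
  apply: s_charged => // i.
  by have := ler_norm (d i); have := ler_norm (- d i); rewrite normrN; case: e1 => ->; lra.
have : \sum_i (`|d i| + e * d i) = 0 by rewrite big1.
rewrite big_split/= -mulr_sumr d0 mulr0 addr0 => /psumr_eq0P d0' i.
by apply/eqP; rewrite -normr_eq0 d0'.
Qed.

End StochasticMatrices.

(** * Concavity as a comparison of slopes *)

Section Concavity.
Context {R : realType}.
Implicit Types (f : R -> R) (a b : R).

(** The slopes are cross-multiplied: no division occurs and the points may coincide. *)
Definition concave_on a b f := forall x y z, a <= x -> x <= y -> y <= z -> z <= b ->
  (f z - f y) * (y - x) <= (f y - f x) * (z - y).

Lemma concave_min a b f s : concave_on a b f ->
  concave_on a b (fun x => Num.min (f x) s).
Proof.
move=> cf x y z ax xy yz zb; have := cf _ _ _ ax xy yz zb.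
have hx : Num.min (f x) s <= f x by rewrite ge_min lexx.
have hx' : Num.min (f x) s <= s by rewrite ge_min lexx orbT.
have hz : Num.min (f z) s <= f z by rewrite ge_min lexx.
have hz' : Num.min (f z) s <= s by rewrite ge_min lexx orbT.
move: hx hx' hz hz'; move: (Num.min (f x) s) (Num.min (f z) s) => p q.
case: (leP (f y) s) => fys hp hp' hq hq' h.
  apply: (@le_trans _ _ ((f z - f y) * (y - x))).
    by apply: ler_wpM2r; lra.
  by apply: le_trans h _; apply: ler_wpM2r; lra.
(* Here [f y] exceeds [s], so the truncated function is maximal at [y]: it does not decrease from
   [x] to [y] nor increase from [y] to [z]. *)
apply: (@le_trans _ _ 0); first by apply: mulr_le0_ge0; lra.
by apply: mulr_ge0; lra.
Qed.

Lemma concave_id a b : concave_on a b id.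
Proof. by move=> x y z *; rewrite mulrC. Qed.

Lemma concave_sum a b (I : finType) (w : I -> R) (f : I -> R -> R) :
  (forall i, 0 <= w i) -> (forall i, concave_on a b (f i)) ->
  concave_on a b (fun x => \sum_i w i * f i x).
Proof.
move=> w0 cf x y z ax xy yz zb; rewrite -!sumrB !mulr_suml.
apply: ler_sum => i _; rewrite -!mulrBr -!mulrA.
by apply: ler_wpM2l => //; apply: cf.
Qed.

Lemma convex_function_slopes (D : interval R) f x y z :
  convex_function [set` D] f -> x \in D -> z \in D -> x <= y -> y <= z ->
  (f y - f x) * (z - y) <= (f z - f y) * (y - x).
Proof.
move=> cf Dx Dz xy yz.
have [xz|zx] := ltP x z; last first.
  have yx : y = x by apply/le_anti; rewrite xy (le_trans yz).
  by rewrite yx !subrr mul0r mulr0.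
have t0 : 0 <= (z - y) / (z - x) by rewrite divr_ge0 ?subr_ge0 ?(ltW xz).
have t1 : (z - y) / (z - x) <= 1 by rewrite ler_pdivrMr ?subr_gt0//; lra.
have := cf (Itv01 t0 t1) x z; rewrite !inE => /(_ Dx Dz).
rewrite convRE [X in f X]convRE /= /unstable.onem.
have zx0 : z - x != 0 by lra.
have -> : (z - y) / (z - x) * x + (1 - (z - y) / (z - x)) * z = y by field.
rewrite -(ler_pM2r (_ : 0 < z - x)) ?subr_gt0//.
have -> : ((z - y) / (z - x) * f x + (1 - (z - y) / (z - x)) * f z) * (z - x) =
  (z - y) * f x + (y - x) * f z by field.
lra.
Qed.

End Concavity.

(** * The lift of the map to [0, 2], its expansion, and its concave inverse *)

Section Lift.
Context {R : realType}.
Variable alpha : R.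
Hypothesis alpha_ge0 : 0 <= alpha.

Let alpha1_gt0 : 0 < 1 + alpha. Proof. by rewrite ltr_pwDl. Qed.

(* T without the reduction mod 1. *)
Definition climb (x : R) := x + x `^ (1 + alpha).

Lemma climb0 : climb 0 = 0.
Proof. by rewrite /climb powR0 ?addr0// gt_eqF. Qed.

Lemma climb1 : climb 1 = 2.
Proof. by rewrite /climb powR1. Qed.

Lemma powR1D x : 0 <= x -> x `^ (1 + alpha) = x * x `^ alpha.
Proof. by move=> x0; rewrite powRD ?(gt_eqF alpha1_gt0)// powRr1. Qed.

(** Follows from [x * x^alpha <= x * y^alpha]. The left-hand side is the guaranteed gain in length
    of an interval under one step. *)
Lemma climb_expand x y : 0 <= x -> x <= y ->
  (y - x) * y `^ alpha <= (climb y - climb x) - (y - x).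
Proof.
move=> x0 xy; have y0 := le_trans x0 xy.
have : x `^ alpha <= y `^ alpha by apply: ge0_ler_powR => //; rewrite nnegrE.
rewrite /climb !powR1D// => h.
have := ler_wpM2l x0 h; lra.
Qed.

Lemma climb_dist x y : 0 <= x -> x <= y -> y - x <= climb y - climb x.
Proof.
move=> x0 xy; have := climb_expand x0 xy.
have := mulr_ge0 (_ : 0 <= y - x) (powR_ge0 y alpha).
rewrite subr_ge0 => /(_ xy); lra.
Qed.

Lemma climb_lt x y : 0 <= x -> x < y -> climb x < climb y.
Proof. by move=> x0 xy; have := climb_dist x0 (ltW xy); lra. Qed.

Lemma climb_le x y : 0 <= x -> x <= y -> climb x <= climb y.
Proof. by move=> x0 xy; have := climb_dist x0 xy; lra. Qed.

Lemma climb_slopes x y z : 0 <= x -> x <= y -> y <= z ->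
  (climb y - climb x) * (z - y) <= (climb z - climb y) * (y - x).
Proof.
move=> x0 xy yz.
have h : 1 <= 1 + alpha by rewrite lerDl.
have xI : x \in `[(0 : R), +oo[ by rewrite in_itv/= x0.
have zI : z \in `[(0 : R), +oo[ by rewrite in_itv/= (le_trans x0) ?(le_trans xy).
have := convex_function_slopes (convex_powR h) xI zI xy yz.
rewrite /climb; move: (_ `^ _) (_ `^ _) (_ `^ _) => X Y Z; lra.
Qed.

(** By convexity the slope on [x, y] is at most the slope on [y, 2], an interval of length at least
    1 on which the increment is at most [climb 2]. *)
Lemma climb_lipschitz x y : 0 <= x -> x <= y -> y <= 1 ->
  climb y - climb x <= climb 2 * (y - x).
Proof.
move=> x0 xy y1; have y0 := le_trans x0 xy.
have y2 : y <= 2 by lra.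
have s := climb_slopes x0 xy y2.
have d := climb_dist x0 xy.
have cy : 0 <= climb y by have := climb_le (lexx 0) y0; rewrite climb0.
have := ler_wpM2l (_ : 0 <= climb y - climb x) (_ : 1 <= 2 - y).
have := ler_wpM2r (_ : 0 <= y - x) (_ : climb 2 - climb y <= climb 2).
rewrite !subr_ge0 => /(_ xy) h1 h2.
have {}h1 := h1 ltac:(lra). have {}h2 := h2 ltac:(lra) ltac:(lra).
lra.
Qed.

Lemma climb_continuous : {within `[0, 1], continuous climb}.
Proof.
apply/subspace_continuousP => x /=; rewrite in_itv/= => /andP[x0 x1].
have L0 : 0 < climb 2 by have := climb_lt (lexx 0) (ltr0n R 2); rewrite climb0.
apply/cvgrPdist_le => e e0.
rewrite near_withinE; near=> y; rewrite /= in_itv/= => /andP[y0 y1].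
have : `|x - y| <= e / climb 2.
  near: y; apply: cvgr_dist_le; first exact: cvg_id.
  by rewrite divr_gt0.
rewrite ler_pdivlMr// mulrC => /(le_trans _); apply.
have [xy|/ltW yx] := leP x y.
  rewrite distrC (distrC x y) !ger0_norm ?subr_ge0 ?climb_le//.
  exact: climb_lipschitz.
rewrite !ger0_norm ?subr_ge0 ?climb_le//; exact: climb_lipschitz.
Unshelve. all: by end_near. Qed.

(* The inverse of [climb : [0, 1] -> [0, 2]]; its values outside [0, 2] are junk. *)
Definition descent (y : R) : R :=
  xget 0 [set x | 0 <= x <= 1 /\ climb x = y].

Lemma descentP y : 0 <= y <= 2 ->
  0 <= descent y <= 1 /\ climb (descent y) = y.
Proof.
move=> y02; rewrite /descent; case: xgetP => [x -> //|no].
have := IVT (ler01 : (0 : R) <= 1) climb_continuous.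
rewrite climb0 climb1 => /(_ y); rewrite min_l// max_r// => /(_ y02)[x].
by rewrite in_itv/= => x01 fx; have := no x; case.
Qed.

Lemma descentK y : 0 <= y <= 2 -> climb (descent y) = y.
Proof. by case/descentP. Qed.

Lemma descent_itv y : 0 <= y <= 2 -> 0 <= descent y <= 1.
Proof. by case/descentP. Qed.

Lemma climb_inj x y : 0 <= x -> 0 <= y -> climb x = climb y -> x = y.
Proof.
move=> x0 y0 e; apply/eqP; rewrite eq_le.
have [xy|yx|//] := ltgtP x y.
  by have := climb_lt x0 xy; rewrite e ltxx.
by have := climb_lt y0 yx; rewrite e ltxx.
Qed.

Lemma climbK x : 0 <= x <= 1 -> descent (climb x) = x.
Proof.
move=> /andP[x0 x1].
have h : 0 <= climb x <= 2.
  by rewrite -climb1 climb_le// andbT -climb0 climb_le.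
by apply: climb_inj => //; [case/andP: (descent_itv h)|rewrite descentK].
Qed.

Lemma descent0 : descent 0 = 0.
Proof. by rewrite -[X in descent X]climb0 climbK// lexx ler01. Qed.

Lemma descent2 : descent 2 = 1.
Proof. by rewrite -climb1 climbK// lexx ler01. Qed.

Lemma descent_lt x y : 0 <= x -> x < y -> y <= 2 -> descent x < descent y.
Proof.
move=> x0 xy y2.
have hx : 0 <= x <= 2 by lra.
have hy : 0 <= y <= 2 by lra.
rewrite ltNge; apply/negP => h.
case/andP: (descent_itv hy) => /climb_le /(_ h).
by rewrite !descentK// leNgt xy.
Qed.

Lemma descent_le x y : 0 <= x -> x <= y -> y <= 2 -> descent x <= descent y.
Proof.
move=> x0; rewrite le_eqVlt => /predU1P[->//|xy y2].
by rewrite ltW// descent_lt.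
Qed.

Lemma descent_dist x y : 0 <= x -> x <= y -> y <= 2 ->
  descent y - descent x <= y - x.
Proof.
move=> x0 xy y2.
have hx : 0 <= x <= 2 by lra.
have hy : 0 <= y <= 2 by lra.
case/andP: (descent_itv hx) => /climb_dist/(_ (descent_le x0 xy y2)).
by rewrite !descentK.
Qed.

(** The inverse of an increasing convex function is concave: the slope inequality of [climb], read
    at the preimages. *)
Lemma descent_concave : concave_on 0 2 descent.
Proof.
move=> x y z x0 xy yz z2.
have hx : 0 <= x <= 2 by lra.
have hy : 0 <= y <= 2 by lra.
have hz : 0 <= z <= 2 by lra.
have xy' := descent_le x0 xy (le_trans yz z2).
have yz' := descent_le (le_trans x0 xy) yz z2.
case/andP: (descent_itv hx) => /climb_slopes /(_ xy' yz').
by rewrite !descentK// mulrC [in X in _ -> _ <= X]mulrC.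
Qed.

Lemma descent_gap y : 0 <= y <= 2 -> y - descent y = descent y `^ (1 + alpha).
Proof. by move=> hy; rewrite -{1}(descentK hy) /climb addrAC subrr add0r. Qed.

Lemma descent_gap_le y : 0 <= y <= 2 -> y - descent y <= y `^ (1 + alpha).
Proof.
move=> hy; rewrite descent_gap//; case/andP: (descent_itv hy) => y0 y1.
apply: ge0_ler_powR; rewrite ?nnegrE ?(ltW alpha1_gt0)//; first by case/andP: hy.
by have := descent_gap hy; have := powR_ge0 (descent y) (1 + alpha); lra.
Qed.

(** Since [descent y <= 1], its power [1 + alpha] is at most [descent y], whence
    [y / 2 <= descent y]. *)
Lemma descent_gap_ge y : 0 <= y <= 2 -> (y / 2) `^ (1 + alpha) <= y - descent y.
Proof.
move=> hy; rewrite descent_gap//; case/andP: (descent_itv hy) => y0 y1.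
apply: ge0_ler_powR; rewrite ?nnegrE ?(ltW alpha1_gt0)//.
  by rewrite divr_ge0//; case/andP: hy.
have := descent_gap hy; rewrite powR1D//.
have : descent y `^ alpha <= 1 `^ alpha by rewrite ge0_ler_powR ?nnegrE.
rewrite powR1 => h; have := ler_wpM2l y0 h; lra.
Qed.

End Lift.

(** * The chain on sorted nodes: uniqueness, and a law with concave distribution function *)

Section SortedPartition.
Context {R : realType}.
Variables (alpha : R) (n : nat) (t : nat -> R).
Hypothesis alpha_ge0 : 0 <= alpha.
Hypothesis t_0 : t 0 = 0.
Hypothesis t_1 : t n.+1 = 1.
Hypothesis t_lt : forall k, (k <= n)%N -> t k < t k.+1.

Local Notation g := (descent alpha).
Local Notation c := (descent alpha 1).

Lemma node_le j k : (j <= k)%N -> (k <= n.+1)%N -> t j <= t k.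
Proof.
move=> /subnK <-; elim: (k - j)%N => // m IH mk.
by apply: le_trans (IH _) (ltW (t_lt _)) => //; apply: ltnW.
Qed.

Lemma node_itv k : (k <= n.+1)%N -> 0 <= t k <= 1.
Proof. by move=> kn; rewrite -t_0 -t_1 !node_le. Qed.

Lemma node_gt0 k : (k <= n)%N -> 0 < t k.+1.
Proof. by move=> kn; apply: le_lt_trans (t_lt kn); case/andP: (node_itv (leqW kn)). Qed.

Definition width k := t k.+1 - t k.

Lemma width_gt0 k : (k <= n)%N -> 0 < width k.
Proof. by move=> kn; rewrite subr_gt0 t_lt. Qed.

Lemma width_neq0 (i : 'I_n.+1) : width i != 0.
Proof. by rewrite gt_eqF// width_gt0// leq_ord. Qed.

(* The length of the part of [t k, t k.+1] lying below x. *)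
Definition slot k x := Num.min x (t k.+1) - Num.min x (t k).

Lemma slot_le k x y : (k <= n)%N -> x <= y -> slot k x <= slot k y.
Proof.
move=> kn xy; have := t_lt kn; rewrite /slot.
by case: (leP x (t k)); case: (leP x (t k.+1)); case: (leP y (t k)); case: (leP y (t k.+1)); lra.
Qed.

Lemma slot_node k j : (k <= n)%N -> (j <= n.+1)%N ->
  slot k (t j) = if (k < j)%N then width k else 0.
Proof.
move=> kn jn; rewrite /slot; case: ltnP => kj.
  by rewrite !min_r// node_le// ltnW.
by rewrite !min_l ?subrr// node_le// ltnW// leqW.
Qed.

Lemma slot_in k x : t k <= x -> x <= t k.+1 -> slot k x = x - t k.
Proof. by move=> kx xk; rewrite /slot min_l// min_r. Qed.

(* If f is the distribution function of nu, then [pull f - f c] is that of T^* nu. *)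
Definition pull (f : R -> R) x := f (g x) + f (g (1 + x)).

Variable P : 'M[R]_n.+1.
(** [slot i] is the distribution function of length restricted to cell [i], so the numerator is the
    length of the part of cell [i] that the map sends into cell [j]. *)
Hypothesis PE : forall i j : 'I_n.+1,
  P i j = (pull (slot i) (t j.+1) - pull (slot i) (t j)) / width i.

Lemma pull_le (f : R -> R) x y : {homo f : x y / x <= y} ->
  0 <= x -> x <= y -> y <= 1 -> pull f x <= pull f y.
Proof.
move=> fle x0 xy y1.
by rewrite lerD// fle// descent_le//; lra.
Qed.

Lemma sorted_stochastic : stochastic P.
Proof.
split=> i => [j|].
  rewrite PE; apply: divr_ge0; last exact/ltW/width_gt0/leq_ord.
  rewrite subr_ge0.
  have [t0 _] := andP (node_itv (ltnW (ltn_ord j))).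
  have [_ t1] := andP (node_itv (ltn_ord j)).
  apply: pull_le => //; last exact/ltW/t_lt/leq_ord.
  by move=> x y; apply/slot_le/leq_ord.
under eq_bigr do rewrite PE.
rewrite -mulr_suml -(big_mkord xpredT (fun j => pull (slot i) (t j.+1) - pull (slot i) (t j))).
(* What remains is [slot i c + slot i 1 - (slot i 0 + slot i c)], where the terms at the
   discontinuity cancel. *)
rewrite telescope_sumr// t_0 t_1 /pull descent0// addr0 -[1 + 1]/2 descent2//.
have s0 : slot i 0 = 0 by rewrite -t_0 slot_node ?leq_ord.
have s1 : slot i 1 = width i by rewrite -t_1 slot_node ?leq_ord// ltn_ord.
by rewrite s0 s1 add0r addrAC subrr add0r divff// width_neq0.
Qed.

Definition cdf (v : 'I_n.+1 -> R) x := \sum_i v i / width i * slot i x.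

Section CumulativeDistribution.
Variable v : 'I_n.+1 -> R.

Lemma cdf_node j : (j <= n.+1)%N -> cdf v (t j) = \sum_(i < n.+1 | (i < j)%N) v i.
Proof.
move=> jn; rewrite [RHS]big_mkcond/=; apply: eq_bigr => i _.
rewrite slot_node ?leq_ord//; case: ifP => _; last by rewrite mulr0.
by rewrite divfK// width_neq0.
Qed.

Lemma cdf0 : cdf v 0 = 0.
Proof. by rewrite -t_0 cdf_node// big_pred0. Qed.

Lemma cdf1 : cdf v 1 = \sum_i v i.
Proof. by rewrite -t_1 cdf_node//; apply: eq_bigl => i; rewrite ltn_ord. Qed.

Lemma cdf_nodeS (j : 'I_n.+1) : cdf v (t j.+1) = cdf v (t j) + v j.
Proof.
rewrite !cdf_node ?(ltnW (ltn_ord j))// (bigD1 j)//= addrC; congr (_ + _).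
by apply: eq_bigl => i; rewrite ltnS [RHS]ltn_neqAle andbC.
Qed.

Lemma cdf_first x : 0 <= x -> x <= t 1 -> cdf v x = v ord0 / width 0 * x.
Proof.
move=> x0 x1; rewrite /cdf (bigD1 ord0)//= big1 ?addr0 => [|i i0].
  by rewrite slot_in ?t_0// subr0.
have xi : x <= t i.
  by apply: le_trans x1 (node_le _ (ltnW (ltn_ord i))); rewrite lt0n.
by rewrite /slot !min_l ?subrr ?mulr0// (le_trans xi)// ltW// t_lt// leq_ord.
Qed.

Lemma pull_cdf x :
  pull (cdf v) x = \sum_i v i / width i * pull (slot i) x.
Proof. by rewrite /pull /cdf -big_split /=; apply: eq_bigr => i _; rewrite -mulrDr. Qed.

(* Conservation of mass on [0, t j]: the preimage of [0, t j] is
   [0, g (t j)] together with [c, g (1 + t j)]. *)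
Lemma invariant_flux j : invariant P v -> (j <= n.+1)%N ->
  cdf v (t j) = pull (cdf v) (t j) - cdf v c.
Proof.
move=> iv; elim: j => [|j IH] jn.
  by rewrite t_0 /pull descent0// addr0 cdf0; ring.
have := cdf_nodeS (Ordinal jn); rewrite /= => ->; rewrite IH ?(ltnW jn)//.
rewrite -[v _](iv (Ordinal jn)) !pull_cdf.
have -> : \sum_i v i * P i (Ordinal jn) = \sum_i v i / width i * pull (slot i) (t j.+1)
    - \sum_i v i / width i * pull (slot i) (t j).
  by rewrite -sumrB; apply: eq_bigr => i _; rewrite PE/= -mulrBr mulrCA mulrC mulrAC.
ring.
Qed.

Hypothesis v_ge0 : forall i, 0 <= v i.

Let wt_ge0 (i : 'I_n.+1) : 0 <= v i / width i.
Proof. by rewrite divr_ge0// ltW// width_gt0// leq_ord. Qed.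

Lemma cdf_le : {homo cdf v : x y / x <= y}.
Proof.
move=> x y xy; apply: ler_sum => i _; apply: ler_wpM2l => //.
exact/slot_le/xy/leq_ord.
Qed.

Lemma cdf_slope_ge (j : 'I_n.+1) p q : t j <= p -> p <= q -> q <= t j.+1 ->
  v j / width j * (q - p) <= cdf v q - cdf v p.
Proof.
move=> jp pq qj; rewrite /cdf -sumrB (bigD1 j)//= -mulrBr.
rewrite (slot_in (le_trans jp pq) qj) (slot_in jp (le_trans pq qj)).
have -> : q - t j - (p - t j) = q - p by ring.
rewrite lerDl; apply: sumr_ge0 => i _; rewrite -mulrBr mulr_ge0// subr_ge0.
exact/slot_le/pq/leq_ord.
Qed.

Lemma node_find x : 0 <= x -> x < 1 -> exists j : 'I_n.+1, t j <= x < t j.+1.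
Proof.
move=> x0; rewrite -t_1.
suff h m : (m <= n.+1)%N -> x < t m -> exists j : 'I_n.+1, t j <= x < t j.+1.
  exact: h.
elim: m => [|m IH] mn; first by rewrite t_0 ltNge x0.
have [mx xm|xm _] := leP (t m) x; last exact: IH (ltnW mn) xm.
by exists (Ordinal mn); rewrite /= mx.
Qed.

(** For a distribution function: the law charges every nondegenerate subinterval of [x, y]. *)
Definition sincr (f : R -> R) x y :=
  forall p q, x <= p -> p < q -> q <= y -> f p < f q.

Lemma sincr_cell (j : 'I_n.+1) : 0 < v j -> sincr (cdf v) (t j) (t j.+1).
Proof.
move=> vj p q jp pq qj; rewrite -subr_gt0.
apply: lt_le_trans (cdf_slope_ge jp (ltW pq) qj).
by rewrite mulr_gt0 ?subr_gt0// divr_gt0// width_gt0// leq_ord.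
Qed.

(* A cell of zero mass has both of its preimages of zero mass, so the image of
   an interval charged everywhere is charged everywhere. *)
Lemma sincr_climb (b : bool) x y : invariant P v ->
  0 <= x -> x < y -> y <= 1 -> b%:R <= climb alpha x -> climb alpha y <= b%:R + 1 ->
  sincr (cdf v) x y ->
  sincr (cdf v) (climb alpha x - b%:R) (climb alpha y - b%:R).
Proof.
move=> iv x0 xy y1 bx yb inc p q xp pq qy; rewrite ltNge; apply/negP => Fqp.
have b0 : 0 <= b%:R :> R by case: b {bx yb xp qy}; rewrite ?ler01.
have b1 : b%:R <= 1 :> R by case: b {bx yb xp qy b0}; rewrite ?ler01.
have p0 : 0 <= p by lra.
have p1 : p < 1 by lra.
have [j /andP[jp pj]] := node_find p0 p1.
have [tj0 _] := andP (node_itv (ltnW (ltn_ord j))).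
have [_ tj1] := andP (node_itv (ltn_ord j)).
(* Cutting at the node keeps [p, r] inside the single cell [j], whose mass must then vanish. *)
pose r := Num.min q (t j.+1).
have pr : p < r by rewrite /r lt_min pq.
have rj : r <= t j.+1 by rewrite ge_min lexx orbT.
have rq : r <= q by rewrite ge_min lexx.
have vj0 : v j = 0.
  have := cdf_slope_ge jp (ltW pr) rj; have := cdf_le rq => Frq s.
  have : v j / width j * (r - p) <= 0 by lra.
  rewrite pmulr_lle0 ?subr_gt0// pmulr_lle0 ?invr_gt0 ?width_gt0 ?leq_ord// => vj.
  by apply/le_anti; rewrite vj v_ge0.
have := cdf_nodeS j; rewrite vj0 addr0 !invariant_flux//; last exact/ltnW/ltn_ord.
move/addIr => e.
have h0 : cdf v (g (t j)) <= cdf v (g (t j.+1)) by apply/cdf_le/descent_le => //; lra.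
have h1 : cdf v (g (1 + t j)) <= cdf v (g (1 + t j.+1)).
  by apply/cdf_le/descent_le => //; lra.
(* Both branch terms of [pull] are nondecreasing and their sums agree at the two nodes by [e], so
   each term is constant over the cell. *)
have eb : cdf v (g (b%:R + t j.+1)) <= cdf v (g (b%:R + t j)).
  by move: e; rewrite /pull; case: b {bx yb xp qy b0 b1}; rewrite /= ?add0r => e; lra.
have : cdf v (g (b%:R + p)) < cdf v (g (b%:R + r)).
  apply: inc.
  - rewrite -[leLHS](climbK alpha_ge0) ?(le_trans (ltW xy))// ?x0//.
    apply: descent_le => //; last by lra.
      by rewrite (le_trans b0).
    by lra.
  - by apply: descent_lt => //; lra.
  - rewrite -[leRHS](climbK alpha_ge0) ?y1 ?(le_trans x0 (ltW xy))//.
    by apply: descent_le => //; lra.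
have h2 : cdf v (g (b%:R + r)) <= cdf v (g (b%:R + t j.+1)).
  by apply/cdf_le/descent_le => //; lra.
have h3 : cdf v (g (b%:R + t j)) <= cdf v (g (b%:R + p)).
  by apply/cdf_le/descent_le => //; lra.
lra.
Qed.

(** This is the condition on the state [s] in [stochastic_invariant_uniq], with the first cell as
    [s]. *)
Lemma first_cell_charged : invariant P v -> v ord0 = 0 -> forall i, v i = 0.
Proof.
move=> iv v00 i; apply/eqP/negPn/negP => vi.
have {}vi : 0 < v i by rewrite lt_neqAle eq_sym vi v_ge0.
pose l := width i; have l0 : 0 < l by apply/width_gt0/leq_ord.
(* A lower bound for the gain in each step: the charged interval has length at least [l], and so its
   right end is at least [l] too. *)
pose k := l * l `^ alpha; have k0 : 0 < k by rewrite mulr_gt0// powR_gt0.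
have F00 : cdf v (t 1) = 0 by have := cdf_nodeS ord0; rewrite /= v00 t_0 cdf0 addr0.
have grow m : exists x y, [/\ 0 <= x, x < y, y <= 1, l + m%:R * k <= y - x &
    sincr (cdf v) x y].
  elim: m => [|m [x [y [x0 xy y1 ylx inc]]]].
    exists (t i), (t i.+1).
    have [? _] := andP (node_itv (ltnW (ltn_ord i))).
    have [_ ?] := andP (node_itv (ltn_ord i)).
    by split; rewrite ?t_lt ?leq_ord ?mul0r ?addr0//; exact: sincr_cell.
  have mk : 0 <= m%:R * k by rewrite mulr_ge0// ltW.
  have yl : l `^ alpha <= y `^ alpha by apply: ge0_ler_powR; rewrite ?nnegrE//; lra.
  have := climb_expand alpha_ge0 x0 (ltW xy) => ce.
  have kk : k <= (y - x) * y `^ alpha.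
    by apply: ler_pM => //; rewrite ?powR_ge0 ?(ltW l0)//; lra.
  have x1 : x <= 1 by lra.
  have y0 : 0 <= y by lra.
  have cxy := climb_lt alpha_ge0 x0 xy.
  have cx0 : 0 <= climb alpha x by rewrite -(climb0 alpha_ge0) climb_le.
  have cy2 : climb alpha y <= 2 by rewrite -(climb1 alpha) climb_le.
  have [c1|c1] := leP (climb alpha y) 1.
    exists (climb alpha x), (climb alpha y); split => //.
      by rewrite -natr1 mulrDl mul1r; lra.
    have := @sincr_climb false x y iv x0 xy y1 _ _ inc.
    by rewrite !subr0 add0r; apply.
  have [c2|c2] := leP 1 (climb alpha x).
    exists (climb alpha x - 1), (climb alpha y - 1); split; [lra|lra|lra| |].
      by rewrite -natr1 mulrDl mul1r; lra.
    by apply: (@sincr_climb true) => //=; lra.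
  (* The interval straddles [c]. The right branch sends [c, y] to an interval starting at 0, so the
     first cell would be charged. *)
  exfalso.
  have h1 : 0 <= (1 : R) <= 2 by rewrite ler01 ler1n.
  have xc : x < g 1 by rewrite -[ltLHS](climbK alpha_ge0) ?x0// descent_lt//; lra.
  have cy : g 1 < y.
    by rewrite -[ltRHS](climbK alpha_ge0) ?y1 ?y0// descent_lt.
  have inc' : sincr (cdf v) (g 1) y.
    by move=> p q cp; apply: inc; apply: le_trans cp; apply: ltW.
  have := @sincr_climb true (g 1) y iv (le_trans x0 (ltW xc)) cy y1 _ _ inc'.
  rewrite descentK//= subrr => /(_ (lexx _) cy2).
  move=> /(_ 0 (Num.min (t 1) (climb alpha y - 1))).
  rewrite lexx lt_min (node_gt0 (leq0n n)) subr_gt0 c1 ge_min lexx orbT cdf0.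
  move=> /(_ isT isT isT); rewrite ltNge -F00 cdf_le//.
  by rewrite ge_min lexx.
(* After more than [1 / k] steps the interval would be longer than 1. *)
have [x [y [x0 xy y1 h _]]] := grow (Num.bound k^-1).
have := archi_boundP (_ : 0 <= k^-1); rewrite invr_ge0 ltW// => /(_ isT).
rewrite -(ltr_pM2r k0) mulVf ?gt_eqF//; lra.
Qed.

End CumulativeDistribution.
Lemma sum_slot k x : (k <= n)%N -> 0 <= x ->
  \sum_(i < n.+1 | (i <= k)%N) slot i x = Num.min x (t k.+1).
Proof.
move=> kn x0; transitivity (\sum_(i < k.+1) slot i x).
  by rewrite (big_ord_widen n.+1 (slot^~ x)).
rewrite -(big_mkord xpredT (slot^~ x)) telescope_sumr// t_0.
by rewrite (min_r x0) subr0.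
Qed.

(* The decreasing densities are the mixtures of the uniform laws on the
   [0, t k.+1]; the chain acts on the mixing weights by a stochastic matrix. *)
Let lump (k i : 'I_n.+1) : R := if (i <= k)%N then width i / t k.+1 else 0.

(** The density on cell [j] after one step from the uniform law on [0, t k.+1]. The value 0 past the
    last cell lets the last drop of the density be written like the others. *)
Let slope (k : 'I_n.+1) j : R := if (j <= n)%N then
  (pull (fun x => Num.min x (t k.+1)) (t j.+1) -
   pull (fun x => Num.min x (t k.+1)) (t j)) / width j / t k.+1 else 0.

(** A decreasing step density is the sum over [j] of its drop at [t j.+1] times the indicator of
    [0, t j.+1]; the factor [t j.+1] turns the indicator into a uniform law. *)
Let mixing : 'M[R]_n.+1 :=
  \matrix_(k, j) ((slope k j - slope k j.+1) * t j.+1).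

Let node_gt0' (k : 'I_n.+1) : 0 < t k.+1. Proof. exact/node_gt0/leq_ord. Qed.

Let sum_lump (w : 'I_n.+1 -> R) k :
  \sum_i lump k i * w i = \sum_(i < n.+1 | (i <= k)%N) width i * w i / t k.+1.
Proof.
rewrite [RHS]big_mkcond/=; apply: eq_bigr => i _; rewrite /lump.
by case: ifP => _; rewrite ?mul0r// mulrAC.
Qed.

Let lump1 k : \sum_i lump k i = 1.
Proof.
under eq_bigr do rewrite -[lump _ _]mulr1.
rewrite sum_lump -mulr_suml; apply/eqP.
rewrite -(inj_eq (mulIf (lt0r_neq0 (node_gt0' k)))) mul1r divfK ?lt0r_neq0//.
under eq_bigr do rewrite mulr1.
apply/eqP; transitivity (\sum_(i < k.+1) width i).
  by rewrite (big_ord_widen n.+1 width).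
by rewrite -(big_mkord xpredT width) telescope_sumr// t_0 subr0.
Qed.

Let lump_step k (j : 'I_n.+1) : \sum_i lump k i * P i j = slope k j * width j.
Proof.
rewrite sum_lump /slope leq_ord mulrAC divfK ?width_neq0// -mulr_suml.
congr (_ / _).
have [tj0 _] := andP (node_itv (ltnW (ltn_ord j))).
have [tjS0 tj1] := andP (node_itv (ltn_ord j)).
have tj1' : t j <= 1 by apply: le_trans tj1; apply/ltW/t_lt/leq_ord.
have h x : 0 <= x -> x <= 1 -> pull (fun x => Num.min x (t k.+1)) x =
    \sum_(i < n.+1 | (i <= k)%N) pull (slot i) x.
  move=> x0 x1; rewrite /pull big_split/= !sum_slot ?leq_ord//.
    by case/andP: (@descent_itv _ alpha alpha_ge0 (1 + x) ltac:(lra)).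
  by case/andP: (@descent_itv _ alpha alpha_ge0 x ltac:(lra)).
rewrite !h// -sumrB; apply: eq_bigr => i _.
by rewrite PE mulrC divfK// width_neq0.
Qed.

(** The truncated inverse [f] is concave, so its mean slopes over consecutive cells decrease on each
    branch. After the last cell the comparison is with 0 and follows from monotonicity. *)
Let slope_dec k (j : 'I_n.+1) : slope k j.+1 <= slope k j.
Proof.
have [tj0 _] := andP (node_itv (ltnW (ltn_ord j))).
have [_ tj1] := andP (node_itv (ltn_ord j)).
have tjj := t_lt (leq_ord j).
set f := fun x => Num.min (descent alpha x) (t k.+1).
have cf : concave_on 0 2 f by apply/concave_min/descent_concave.
rewrite /slope leq_ord; case: ifP => jn; last first.
  apply: divr_ge0; last exact/ltW/node_gt0'.
  apply: divr_ge0; last exact/ltW/width_gt0/leq_ord.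
  rewrite subr_ge0; apply: pull_le => //; last exact: ltW.
  by move=> x y xy; rewrite le_min !ge_min lexx orbT xy.
rewrite ler_pM2r ?invr_gt0// ler_pdivrMr ?width_gt0// mulrAC.
rewrite ler_pdivlMr ?width_gt0 ?leq_ord//.
have [_ tj2] := andP (node_itv (jn : (j.+2 <= n.+1)%N)).
have tjj' := t_lt jn.
have := cf (t j) (t j.+1) (t j.+2) tj0 (ltW tjj) (ltW tjj') ltac:(lra).
have := cf (1 + t j) (1 + t j.+1) (1 + t j.+2) ltac:(lra) ltac:(lra) ltac:(lra) ltac:(lra).
have E i : pull (Num.min^~ (t k.+1)) (t i) = f (t i) + f (1 + t i) by [].
rewrite !E /width.
move: (f _) (f _) (f _) (f _) (f _) (f _) => a1 a2 a3 a4 a5 a6.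
nra.
Qed.

(** The drops of the density from cell [i] on telescope to its value there. With [lump_step], the
    product of [mixing] and [lump] equals that of [lump] and [P]. *)
Let mixing_lump k (i : 'I_n.+1) : \sum_j mixing k j * lump j i = slope k i * width i.
Proof.
rewrite /lump.
transitivity (\sum_(i <= j < n.+1) (slope k j - slope k j.+1) * width i).
  rewrite big_geq_mkord [RHS]big_mkcond/=; apply: eq_bigr => j _; rewrite mxE.
  case: ifP => _; last by rewrite mulr0.
  by rewrite -mulrA [t _ * _]mulrC divfK// lt0r_neq0.
rewrite -mulr_suml; congr (_ * _).
transitivity (\sum_(i <= j < n.+1) (- slope k j.+1 - - slope k j)).
  by apply: eq_bigr => j _; rewrite opprK addrC.
rewrite (telescope_sumr (fun j => - slope k j) (ltnW (ltn_ord i))).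
by rewrite {1}/slope ltnn opprK oppr0 add0r.
Qed.

(** The row sums come from the intertwining, as those of [lump] and [P] are 1. *)
Let mixing_stochastic : stochastic mixing.
Proof.
split=> [k j|k].
  by rewrite mxE mulr_ge0 ?(ltW (node_gt0' _))// subr_ge0 slope_dec.
transitivity (\sum_j mixing k j * \sum_i lump j i).
  by apply: eq_bigr => j _; rewrite lump1 mulr1.
transitivity (\sum_i \sum_j mixing k j * lump j i).
  by rewrite exchange_big; apply: eq_bigr => j _; rewrite mulr_sumr.
transitivity (\sum_i \sum_l lump k l * P l i).
  by apply: eq_bigr => j _; rewrite mixing_lump lump_step.
rewrite -[RHS](lump1 k).
by rewrite stochastic_sum//; exact: sorted_stochastic.
Qed.

Lemma concave_invariant_ex : exists v : 'I_n.+1 -> R,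
  [/\ forall i, 0 <= v i, \sum_i v i = 1, invariant P v & concave_on 0 1 (cdf v)].
Proof.
(* Invariant mixing weights, which [lump] carries to an invariant law of [P] with decreasing
   density. *)
have [r [r0 r1 ri]] := stochastic_invariant_ex mixing_stochastic (ltn0Sn n).
exists (fun i => \sum_k r k * lump k i); split.
- move=> i; apply: sumr_ge0 => k _; rewrite mulr_ge0// /lump; case: ifP => // _.
  by rewrite divr_ge0// ltW ?node_gt0'// width_gt0// leq_ord.
- rewrite exchange_big/= -[RHS]r1; apply: eq_bigr => k _.
  by rewrite -mulr_sumr lump1 mulr1.
- move=> j; under eq_bigr do rewrite mulr_suml.
  rewrite exchange_big/=.
  under eq_bigr => k _.
    under eq_bigr do rewrite -mulrA.
    rewrite -mulr_sumr lump_step -mixing_lump mulr_sumr.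
    under eq_bigr do rewrite mulrA.
    over.
  rewrite exchange_big/=; apply: eq_bigr => k _.
  by rewrite -mulr_suml ri.
- have E x : 0 <= x -> cdf (fun i => \sum_k r k * lump k i) x =
      \sum_k (r k / t k.+1) * Num.min x (t k.+1).
    move=> x0; rewrite /cdf; under eq_bigr do rewrite !mulr_suml.
    rewrite exchange_big/=; apply: eq_bigr => k _.
    rewrite -sum_slot ?leq_ord// mulr_sumr [RHS]big_mkcond/=.
    apply: eq_bigr => i _; rewrite /lump; case: ifP => _; last by rewrite mulr0 !mul0r.
    by rewrite mulrA [X in X * slot _ _]mulrAC mulfK// width_neq0.
  move=> x y z x0 xy yz z1.
  have y0 := le_trans x0 xy; have z0 := le_trans y0 yz.
  rewrite (E x)// (E y)// (E z)//.
  have rt (k : 'I_n.+1) : 0 <= r k / t k.+1 by rewrite divr_ge0// ltW.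
  have := concave_sum rt (fun k => concave_min (t k.+1) (@concave_id R 0 1)).
  by apply.
Qed.

End SortedPartition.

(** * Consequences of mass conservation for a concave distribution function *)

Section FluxEstimates.
Context {R : realType}.
Variables (alpha : R) (F : R -> R).
Hypothesis alpha_ge0 : 0 <= alpha.
Hypothesis F_concave : concave_on 0 1 F.
Hypothesis F_le : {homo F : x y / x <= y}.
Hypothesis F0 : F 0 = 0.
Hypothesis F1 : F 1 = 1.

Local Notation g := (descent alpha).
Local Notation c := (descent alpha 1).

(** The identity of [invariant_flux] at a single point; the nodes will satisfy it. *)
Definition balance x := F x = F (g x) + F (g (1 + x)) - F c.

Let c_itv : 0 < c < 1.
Proof.
have a0 := alpha_ge0.
have h := @descent_lt _ _ a0 0 1 (lexx 0) ltr01 (ler1n R 2).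
have h' := @descent_lt _ _ a0 1 2 ler01 (ltr1n R 2) (lexx 2).
by move: h h'; rewrite descent0// descent2// => -> ->.
Qed.

Let g1_itv x : 0 <= x -> x <= 1 -> [/\ c <= g (1 + x), g (1 + x) <= 1 & g (1 + x) - c <= x].
Proof.
move=> x0 x1; split.
- by apply: descent_le => //; lra.
- by case/andP: (@descent_itv _ _ alpha_ge0 (1 + x) ltac:(lra)).
- have := @descent_dist _ _ alpha_ge0 1 (1 + x) ltac:(lra) ltac:(lra) ltac:(lra); lra.
Qed.

Let g_itv x : 0 <= x -> x <= 1 -> 0 <= g x <= x.
Proof.
move=> x0 x1; have x02 : 0 <= x <= 2 by lra.
have /andP[-> _] := descent_itv alpha_ge0 x02.
by have := descent_gap alpha_ge0 x02; have := powR_ge0 (g x) (1 + alpha); lra.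
Qed.

(** The mass of [g x, x] equals the mass that enters [0, x] from the right branch, at most
    [1 - F c]. By concavity the mean density on [g x, x] is at least that on [x, 1]. *)
Lemma tail_le x : 0 < x -> x <= 1 -> balance x ->
  (1 - F x) * (x / 2) `^ (1 + alpha) <= 1 - F c.
Proof.
move=> x0 x1 bx.
have /andP[gx0 gx] := g_itv (ltW x0) x1.
have [_ g1 _] := g1_itv (ltW x0) x1.
have Fx : F x <= 1 by rewrite -[leRHS]F1 F_le.
have := F_concave gx0 gx x1 (lexx 1); rewrite F1.
have := @descent_gap_ge _ _ alpha_ge0 x ltac:(lra) => gap h.
apply: (@le_trans _ _ ((1 - F x) * (x - g x))).
  by apply: ler_wpM2l => //; rewrite subr_ge0.
apply: le_trans h _.
have Fgx := F_le gx.
have : F (g (1 + x)) <= 1 by rewrite -[leRHS]F1 F_le.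
move: bx; rewrite /balance => bx ?.
apply: (@le_trans _ _ ((F x - F (g x)) * 1)).
  by apply: ler_wpM2l; rewrite ?subr_ge0//; lra.
lra.
Qed.

Variable a : R.
Hypothesis a_gt0 : 0 < a.
Hypothesis a_le1 : a <= 1.
Hypothesis a_balance : balance a.
Hypothesis F_linear : F (g a) * a = F a * g a.

(** The mass that the right branch sends into [0, a]; [Phi_eq] equates it with the mass that leaves
    [0, a]. *)
Let Phi := F (g (1 + a)) - F c.

Let Phi_eq : F a * (a - g a) = a * Phi.
Proof. by rewrite /Phi; move: a_balance F_linear; rewrite /balance => -> h; lra. Qed.

(** Beyond [c] the slope of [F] is at most its mean slope on [0, c], hence at most [1 / c], and the
    preimage [c, g (1 + a)] has length at most [a]. *)
Lemma first_cell_le : F a * (a / 2) `^ (1 + alpha) * c <= a ^+ 2.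
Proof.
have [a0 a1] := (ltW a_gt0, a_le1).
have /andP[c0 c1] := c_itv.
have [h1 h2 h3] := g1_itv a0 a1.
have := F_concave (lexx 0) (ltW c0) h1 h2; rewrite F0 !subr0 -/Phi => h.
have Fc : F c <= 1 by rewrite -[leRHS]F1 F_le// ltW.
have Fc0 : 0 <= F c by rewrite -[leLHS]F0 F_le// ltW.
have Fa0 : 0 <= F a by rewrite -[leLHS]F0 F_le.
have Pc : Phi * c <= a.
  apply: le_trans h _; rewrite -[leRHS]mul1r; apply: ler_pM => //.
  by rewrite subr_ge0.
have := @descent_gap_ge _ _ alpha_ge0 a ltac:(lra) => gap.
rewrite expr2; apply: (@le_trans _ _ (a * (Phi * c))); last exact: ler_wpM2l.
rewrite mulrA -Phi_eq; apply: ler_wpM2r; first exact: ltW.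
exact: ler_wpM2l.
Qed.

(** Concavity of [F] bounds the density on [c, g (1 + a)] below by [(1 - F c) / (1 - c)]; concavity
    of [g] bounds the length below by [(1 - c) * a]. The factors [1 - c] cancel. *)
Lemma right_branch_le : (1 - F c) * a <= F a * a `^ alpha.
Proof.
have [a0 a1] := (ltW a_gt0, a_le1).
have /andP[c0 c1] := c_itv.
have [h1 h2 h3] := g1_itv a0 a1.
have := F_concave (ltW c0) h1 h2 (lexx 1); rewrite F1 -/Phi => h.
have := @descent_concave _ _ alpha_ge0 1 (1 + a) 2.
rewrite descent2// => /(_ ltac:(lra) ltac:(lra) ltac:(lra) ltac:(lra)) h'.
have hg : (1 - c) * a <= g (1 + a) - c by lra.
have Fa0 : 0 <= F a by rewrite -[leLHS]F0 F_le.
have Fc : F c <= 1 by rewrite -[leRHS]F1 F_le// ltW.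
have gap := @descent_gap_le _ _ alpha_ge0 a ltac:(lra).
have P0 : (1 - F c) * a <= Phi.
  rewrite -(ler_pM2r (_ : 0 < 1 - c)) ?subr_gt0//.
  apply: (@le_trans _ _ ((1 - F c) * (g (1 + a) - c))).
    by rewrite -mulrA (mulrC a); apply: ler_wpM2l => //; rewrite subr_ge0.
  rewrite /Phi in h *; lra.
apply: le_trans P0 _; rewrite -(ler_pM2l a_gt0) -Phi_eq.
rewrite mulrCA -powR1D//; exact: ler_wpM2l.
Qed.

Lemma head_le x : a <= x -> x <= 1 -> F x * a <= F a * x.
Proof.
move=> ax x1; have := F_concave (lexx 0) (ltW a_gt0) ax x1; rewrite F0; lra.
Qed.

End FluxEstimates.

(** * Ordering the cells of a partition from left to right *)

Section CellSorting.
Context {R : realType}.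
Variable D : cell_partition R.
Local Notation n := (ncells D).

(** Records the end points of a cell and forgets which of them belong to it. *)
Definition spans (i : 'I_n.+1) (l r : R) :=
  [/\ l < r, [set` `]l, r[] `<=` [set` cell D i] & [set` cell D i] `<=` [set` `[l, r]]].

Lemma cell_spans i : exists lr : R * R, spans i lr.1 lr.2.
Proof.
have := @cell_pos _ D i; have := @cell_fin _ D i.
rewrite /spans lebesgue_measure_itv; case: ifP => [lr|_ _]; last by rewrite ltxx.
case: (cell D i) lr => [[a l|[]] [b r|[]]] //=; rewrite lte_fin => lr _ _.
by exists (l, r); split=> //= x; rewrite /= !in_itv/=; case: a; case: b => /= ?; lra.
Qed.

Lemma spans_measure i l r : spans i l r ->
  lebesgue_measure [set` cell D i] = (r - l)%:E.
Proof.
move=> [lr lo up].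
have mc : lebesgue_measure (`[l, r] : set R) = (r - l)%:E.
  by rewrite lebesgue_measure_itv/= lte_fin lr.
have mo : lebesgue_measure (`]l, r[ : set R) = (r - l)%:E.
  by rewrite lebesgue_measure_itv/= lte_fin lr.
apply/le_anti; rewrite -{1}mc -mo.
by apply/andP; split; exact: le_outer_measure.
Qed.

Lemma spans_len i l r : spans i l r -> len D i = r - l.
Proof. by move=> /spans_measure; rewrite /len => ->. Qed.

Lemma spans_itv i l r : spans i l r -> 0 <= l /\ r <= 1.
Proof.
move=> [lr lo up].
have sub x : l < x -> x < r -> 0 <= x <= 1.
  move=> lx xr; have := lo x; rewrite /= in_itv/= lx xr => /(_ isT).
  by move=> /cell_sub01; rewrite /= in_itv.
split.
  rewrite leNgt; apply/negP => l0.
  have := sub ((l + Num.min 0 r) / 2).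
  by case: (leP 0 r) => r0 /(_ ltac:(lra) ltac:(lra)); lra.
rewrite leNgt; apply/negP => r1.
have := sub ((r + Num.max 1 l) / 2).
by case: (leP 1 l) => l1 /(_ ltac:(lra) ltac:(lra)); lra.
Qed.

Lemma spans_disj i j l r l' r' : i != j -> spans i l r -> spans j l' r' ->
  l <= l' -> r <= l'.
Proof.
move=> ij [lr lo _] [lr' lo' _] ll; rewrite leNgt; apply/negP => lr''.
pose m := (l' + Num.min r r') / 2.
have h : l' < m /\ m < Num.min r r'.
  by rewrite /m; case: (leP r r') => ?; split; lra.
have [m1 +] := h; rewrite lt_min => /andP[m2 m3].
have : [set` cell D i] m by apply: lo; rewrite /= in_itv/= m2 (le_lt_trans ll).
have : [set` cell D j] m by apply: lo'; rewrite /= in_itv/= m1.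
move=> mj mi; have := cell_disjI ij.
by rewrite -subset0 => /(_ m); apply.
Qed.

Lemma sum_len : \sum_i len D i = 1.
Proof.
apply: EFin_inj; rewrite -sumEFin.
under eq_bigr do rewrite fineK ?cell_fin//.
rewrite -(measure_bigsetU_ord (@lebesgue_measure R) xpredT); last 2 first.
- by move=> i; exact: measurable_itv.
- exact: (@cell_disj _ D).
rewrite -bigcup_seq.
have -> : [set` index_enum (ordinal n.+1)] = setT.
  by apply/seteqP; split => // i _ /=; rewrite mem_index_enum.
rewrite (@cell_cover _ D).
transitivity (lebesgue_measure (`[0, 1] : set R)); first by [].
by rewrite lebesgue_measure_itv/= lte_fin ltr01 -EFinB subr0.
Qed.

(** The nodes are partial sums of lengths of the cells sorted by left end. Disjointness bounds each
    left end below by its node (induction from 0) and each right end above by the next node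
    (induction from 1); as the lengths sum to 1, the bounds are equalities. *)
Lemma cell_sorting : exists (s : 'I_n.+1 -> 'I_n.+1) (t : nat -> R),
  [/\ injective s, t 0 = 0, t n.+1 = 1, (forall k, (k <= n)%N -> t k < t k.+1) &
      forall i : 'I_n.+1, spans (s i) (t i) (t i.+1)].
Proof.
have [lr lrP] := choice cell_spans.
pose leL i j := (lr i).1 <= (lr j).1.
pose q := sort leL (enum 'I_n.+1).
have pq : perm_eq q (enum 'I_n.+1) by rewrite perm_sort.
have sq : size q = n.+1 by rewrite size_sort size_enum_ord.
have uq : uniq q by rewrite sort_uniq enum_uniq.
have leL_trans : transitive leL by move=> y x z; exact: le_trans.
have so : sorted leL q by apply: sort_sorted => x y; exact: le_total.
pose s k := nth ord0 q k.
pose t k := \sum_(0 <= i < k) len D (s i).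
have lenE i : len D i = (lr i).2 - (lr i).1 by exact/spans_len/lrP.
have tS k : t k.+1 = t k + len D (s k) by rewrite /t big_nat_recr.
have t0 : t 0 = 0 by rewrite /t big_geq.
have t1 : t n.+1 = 1.
  rewrite -sum_len; transitivity (\sum_(i <- enum 'I_n.+1) len D i).
    by rewrite -(perm_big _ pq) (big_nth ord0) sq.
  by rewrite big_enum.
have next k : (k < n)%N -> (lr (s k)).2 <= (lr (s k.+1)).1.
  move=> kn; apply: (spans_disj _ (lrP (s k)) (lrP (s k.+1))).
    by rewrite nth_uniq ?sq ?(leqW kn)// ltn_eqF.
  by apply: (sorted_leq_nth leL_trans) => //; rewrite ?inE ?sq ?(leqW kn)// => x; exact: lexx.
have lo k : (k <= n)%N -> t k <= (lr (s k)).1.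
  elim: k => [_|k IH kn]; first by rewrite t0; case: (spans_itv (lrP (s 0%N))).
  apply: le_trans (next k kn); rewrite tS lenE.
  by have := IH (ltnW kn); lra.
have up k : (k <= n)%N -> (lr (s (n - k)%N)).2 <= t (n - k).+1.
  elim: k => [_|k IH kn]; first by rewrite subn0 t1; case: (spans_itv (lrP (s n))).
  have nk : (n - k = (n - k.+1).+1)%N by rewrite subnSK.
  have := IH (ltnW kn); rewrite nk tS lenE.
  have := next (n - k.+1)%N; rewrite -nk leq_subr => /(_ isT); lra.
have lr1 k : (k <= n)%N -> (lr (s k)).1 = t k /\ (lr (s k)).2 = t k.+1.
  move=> kn; have := up (n - k)%N (leq_subr _ _); rewrite subKn//.
  have := lo k kn; rewrite tS lenE => h1 h2.
  by split; apply/le_anti/andP; split; lra.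
exists (fun i => s i), t; split => //.
- by move=> i j /eqP; rewrite nth_uniq ?sq// => /eqP /val_inj.
- by move=> k kn; rewrite tS ltrDl len_gt0.
- move=> i; have [<- <-] := lr1 i (leq_ord i); exact: lrP.
Qed.

End CellSorting.

(** * Transition probabilities through the inverse branches *)

Section TransitionMatrix.
Context {R : realType}.
Variable alpha : R.
Hypothesis alpha_ge0 : 0 <= alpha.
Local Notation g := (descent alpha).

Lemma Tmap_left x : 0 <= x -> climb alpha x < 1 -> Tmap alpha x = climb alpha x.
Proof.
move=> x0 cx; rewrite /Tmap -/(climb alpha x) (_ : Num.floor _ = 0) ?subr0//.
apply: floor_def; rewrite add0r cx andbT.
by rewrite -[leLHS](climb0 alpha_ge0) climb_le.
Qed.

Lemma Tmap_right x : 1 <= climb alpha x < 2 -> Tmap alpha x = climb alpha x - 1.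
Proof.
by move=> cx; rewrite /Tmap -/(climb alpha x) (_ : Num.floor _ = 1)//; apply: floor_def.
Qed.

Lemma climb_lt_descent x y : 0 <= x <= 1 -> 0 <= y <= 2 ->
  (climb alpha x < y) = (x < g y).
Proof.
move=> /andP[x0 x1] hy; have /andP[g0 _] := descent_itv alpha_ge0 hy.
apply/idP/idP => h; rewrite ltNge; apply/negP.
  by move=> /(climb_le alpha_ge0 g0); rewrite descentK// leNgt h.
by move: (climb_lt alpha_ge0 x0 h); rewrite descentK// ltNge => /negP.
Qed.

Lemma descent_lt_climb x y : 0 <= x <= 1 -> 0 <= y <= 2 ->
  (y < climb alpha x) = (g y < x).
Proof.
move=> /andP[x0 x1] hy; have /andP[g0 _] := descent_itv alpha_ge0 hy.
apply/idP/idP => h; rewrite ltNge; apply/negP.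
  by move=> /(climb_le alpha_ge0 x0); rewrite descentK// leNgt h.
by move: (climb_lt alpha_ge0 g0 h); rewrite descentK// ltNge => /negP.
Qed.

(** The formula covers empty overlaps as well. The booleans allow open and closed intervals, which
    bound the preimage from inside and outside in [transition_measure]. *)
Lemma measure_overlap (a b u v : R) (bl br : bool) : a < b -> u <= v ->
  lebesgue_measure [set` Interval (BSide bl (Num.max a u)) (BSide br (Num.min b v))] =
  ((Num.min v b - Num.min v a) - (Num.min u b - Num.min u a))%:E.
Proof.
move=> ab uv; rewrite lebesgue_measure_itv/= lte_fin.
by case: ifPn => [|]; rewrite ?EFinB -?EFinB; move=> h; congr _%:E; move: h;
  case: (leP a u); case: (leP b v); case: (leP v b); case: (leP v a);
  case: (leP u b); case: (leP u a) => *; lra.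
Qed.

Variable D : cell_partition R.

Lemma transition_measure (i j : 'I_(ncells D).+1) (a b p q : R) : spans i a b -> spans j p q ->
  lebesgue_measure ([set` cell D i] `&` Tmap alpha @^-1` [set` cell D j]) =
  (((Num.min (g q) b - Num.min (g q) a) - (Num.min (g p) b - Num.min (g p) a)) +
   ((Num.min (g (1 + q)) b - Num.min (g (1 + q)) a) -
    (Num.min (g (1 + p)) b - Num.min (g (1 + p)) a)))%:E.
Proof.
move=> si sj; have [a0 b1] := spans_itv si; have [p0 q1] := spans_itv sj.
case: si sj => [ab loi upi] [pq loj upj].
have gpq : g p <= g q by apply: descent_le => //; lra.
have gq1 : g q <= g (1 + p) by apply: descent_le => //; lra.
have gpq' : g (1 + p) <= g (1 + q) by apply: descent_le => //; lra.
have hp : 0 <= p <= 2 by lra.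
have hq : 0 <= q <= 2 by lra.
have hp' : 0 <= 1 + p <= 2 by lra.
have hq' : 0 <= 1 + q <= 2 by lra.
rewrite EFinD; apply/le_anti/andP; split.
  rewrite -(measure_overlap true false ab gpq) -(measure_overlap true false ab gpq').
  apply: (@le_trans _ _ (lebesgue_measure
    ((`[Num.max a (g p), Num.min b (g q)] `|`
      `[Num.max a (g (1 + p)), Num.min b (g (1 + q))]) `|` [set (1 : R)]))).
    apply: le_outer_measure => x [xi]; rewrite /preimage/= => xj.
    have := upi _ xi; rewrite /= in_itv/= => /andP[ax xb].
    (* At 1 the map takes the value 0 and not its left limit 1; the point is set aside as a null
       set. *)
    have [->|x1] := eqVneq x 1; [by right|left].
    have x01 : 0 <= x <= 1 by lra.
    have {}x1 : x < 1 by rewrite lt_neqAle x1; case/andP: x01.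
    have cx2 : climb alpha x < 2 by rewrite -(climb1 alpha) climb_lt//; lra.
    have [cx|cx] := ltP (climb alpha x) 1.
      left; have := upj _ xj; rewrite Tmap_left//; last by lra.
      rewrite /= !in_itv/= ge_max le_min ax xb/= => /andP[].
      by rewrite !leNgt climb_lt_descent// descent_lt_climb// => -> ->.
    right; have := upj _ xj; rewrite Tmap_right ?cx//.
    rewrite /= !in_itv/= ge_max le_min ax xb/= lerBrDl lerBlDl => /andP[].
    by rewrite !leNgt climb_lt_descent// descent_lt_climb// => -> ->.
  apply: le_trans (outer_measureU2 _ _ _) _.
  rewrite [X in (_ + X)%E]lebesgue_measure_set1 adde0.
  exact: outer_measureU2.
rewrite -(measure_overlap false true ab gpq) -(measure_overlap false true ab gpq').
rewrite -measureU; last 3 first.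
- exact: measurable_itv.
- exact: measurable_itv.
- rewrite -subset0 => x [] /=; rewrite !in_itv/= !gt_max !lt_min.
  by move=> /andP[_ /andP[_ h1]] /andP[/andP[_ h2] _]; lra.
apply: le_outer_measure => x [] /=; rewrite in_itv/= gt_max lt_min.
  move=> /andP[/andP[ax px] /andP[xb xq]].
  have x01 : 0 <= x <= 1 by lra.
  split; first by apply: loi; rewrite /= in_itv/= ax xb.
  apply: loj; rewrite /preimage/= in_itv/=.
  move: px xq; rewrite -climb_lt_descent// -descent_lt_climb// => px xq.
  by rewrite Tmap_left ?px//; lra.
move=> /andP[/andP[ax px] /andP[xb xq]].
have x01 : 0 <= x <= 1 by lra.
split; first by apply: loi; rewrite /= in_itv/= ax xb.
apply: loj; rewrite /preimage/= in_itv/=.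
move: px xq; rewrite -climb_lt_descent// -descent_lt_climb// => px xq.
by rewrite Tmap_right; lra.
Qed.

End TransitionMatrix.

(** * Transfer of the results on sorted nodes to the chain of a partition *)

Section PartitionChain.
Context {R : realType}.
Variables (alpha : R) (D : cell_partition R).
Hypothesis alpha_ge0 : 0 <= alpha.
Local Notation n := (ncells D).
Local Notation T := (trans_mx (Tmap alpha) D).
Variables (s : 'I_n.+1 -> 'I_n.+1) (t : nat -> R).
Hypothesis s_inj : injective s.
Hypothesis t_0 : t 0 = 0.
Hypothesis t_1 : t n.+1 = 1.
Hypothesis t_lt : forall k, (k <= n)%N -> t k < t k.+1.
Hypothesis s_spans : forall i : 'I_n.+1, spans (s i) (t i) (t i.+1).

Let P : 'M[R]_n.+1 := \matrix_(i, j) T (s i) (s j).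

Let PE (i j : 'I_n.+1) : P i j =
  (pull alpha (slot t i) (t j.+1) - pull alpha (slot t i) (t j)) / width t i.
Proof.
rewrite !mxE (transition_measure alpha_ge0 (s_spans i) (s_spans j))/=.
by rewrite (spans_len (s_spans i)) /width /pull /slot; congr (_ / _); ring.
Qed.

Let s_surj i : exists j, s j = i.
Proof. by exists (invF s_inj i); rewrite f_invF. Qed.

Let sorted_invariant v : invariant T v <-> invariant P (v \o s).
Proof.
have E k : \sum_i (v \o s) i * P i k = \sum_i v i * T i (s k).
  by rewrite [RHS](reindex_inj s_inj); apply: eq_bigr => i _; rewrite mxE.
split=> iv k; first by rewrite E iv.
by have [j <-] := s_surj k; rewrite -E iv.
Qed.

Let sorted_sum (rho : distr R n.+1) : \sum_i (rho \o s) i = 1.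
Proof. by rewrite -(distr_sum rho) [RHS](reindex_inj s_inj). Qed.

Let sP := sorted_stochastic alpha_ge0 t_0 t_1 t_lt PE.
Let charged := first_cell_charged alpha_ge0 t_0 t_1 t_lt PE.

Lemma partition_distr_ex : exists pi : distr R n.+1,
  stationary T pi /\ concave_on 0 1 (cdf t (pi \o s)).
Proof.
have [v [v0 v1 iv cv]] := concave_invariant_ex alpha_ge0 t_0 t_1 t_lt PE.
pose w := [ffun i => v (invF s_inj i)] : {ffun 'I_n.+1 -> R}.
have ws : w \o s = v by apply/funext => i; rewrite /= ffunE invF_f.
have wP : [forall i, 0 <= w i] && (\sum_i w i == 1).
  apply/andP; split; first by apply/forallP => i; rewrite ffunE.
  rewrite (reindex_inj s_inj) -v1; apply/eqP; apply: eq_bigr => i _.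
  by rewrite -[in RHS]ws.
exists (Distr wP); rewrite /= ws; split => //.
by apply/sorted_invariant; rewrite /= ws.
Qed.

Lemma partition_uniquely_ergodic : uniquely_ergodic T.
Proof.
have [pi [st _]] := partition_distr_ex; exists pi; split => // rho st'.
have uniq := stochastic_invariant_uniq sP (fun v v0 iv => charged v0 iv).
apply/val_inj/ffunP => i; have [j <-] := s_surj i.
apply: (uniq (pi \o s) (rho \o s)); [exact/sorted_invariant|exact/sorted_invariant|].
by rewrite !sorted_sum.
Qed.

Let pi := invariant_distr T.
Let F := cdf t (pi \o s).

Let pi_invariant : invariant P (pi \o s).
Proof. exact/sorted_invariant/(invariant_distrP _ partition_uniquely_ergodic). Qed.

(** By uniqueness the invariant law is the one built in [partition_distr_ex]. *)
Let F_concave : concave_on 0 1 F.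
Proof.
have [rho [/(invariant_distrP _ partition_uniquely_ergodic) e cv]] := partition_distr_ex.
by rewrite /F /pi -e.
Qed.

Let F_le : {homo F : x y / x <= y}.
Proof. by apply: cdf_le => // i; exact: distr_ge0. Qed.

Let F0 : F 0 = 0. Proof. exact: cdf0. Qed.

Let F1 : F 1 = 1.
Proof. by rewrite /F (cdf1 t_1 t_lt) sorted_sum. Qed.

Let F_balance k : (k <= n.+1)%N -> balance alpha F (t k).
Proof.
move=> kn; rewrite /balance {1}/F.
by rewrite (invariant_flux alpha_ge0 t_0 t_lt PE pi_invariant kn).
Qed.

Let origin_first : origin_cell D = s ord0.
Proof.
have [j sj] := s_surj (origin_cell D); rewrite -sj; congr s; apply/val_inj => /=.
case: (s_spans j) => _ _ /(_ 0) /=; rewrite sj => /(_ (origin_cellP D)).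
rewrite in_itv/= => /andP[tj0 _]; apply/eqP; rewrite -leqn0 leqNgt; apply/negP => j0.
have := node_le t_lt j0 (ltnW (ltn_ord j)).
by have := t_lt (leq0n n); rewrite t_0; lra.
Qed.

Let a := len D (origin_cell D).

Let aE : a = t 1.
Proof. by rewrite /a origin_first (spans_len (s_spans ord0)) t_0 subr0. Qed.

Let a_gt0 : 0 < a. Proof. exact: len_gt0. Qed.

Let a_le1 : a <= 1.
Proof. by rewrite aE -t_1; apply: (node_le t_lt). Qed.

Let Fa : F a = pi (origin_cell D).
Proof.
rewrite aE /F (cdf_nodeS t_lt _ ord0) /= t_0 cdf0//.
by rewrite add0r origin_first.
Qed.

Let F_linear : F (descent alpha a) * a = F a * descent alpha a.
Proof.
have a02 : 0 <= a <= 2 by have := a_gt0; have := a_le1; lra.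
have /andP[d0 _] := descent_itv alpha_ge0 a02.
have da : descent alpha a <= a.
  by rewrite -subr_ge0 descent_gap// powR_ge0.
have at1 : a <= t 1 by rewrite aE.
rewrite /F !(cdf_first t_0 t_lt)// ?(ltW a_gt0)//.
  by rewrite mulrAC.
exact: le_trans da _.
Qed.

Lemma origin_mass_le :
  pi (origin_cell D) * (a / 2) `^ (1 + alpha) * descent alpha 1 <= a ^+ 2.
Proof.
rewrite -Fa; apply: (first_cell_le alpha_ge0 F_concave F_le F0 F1) => //.
by rewrite aE; exact: F_balance.
Qed.

Let cell_measure_tail_le k x : (k <= n.+1)%N -> t k <= x ->
  (cell_measure pi [set y | (x < y)%R] <= (1 - F (t k))%:E)%E.
Proof.
move=> kn tkx.
have -> : 1 - F (t k) = \sum_(i < n.+1) if (i < k)%N then 0 else pi (s i).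
  rewrite -(sorted_sum pi) /F (cdf_node t_lt)//.
  rewrite [X in X - _](bigID (fun i : 'I_n.+1 => (i < k)%N))/=.
  rewrite addrAC subrr add0r big_mkcond/=.
  by apply: eq_bigr => i _; case: ltnP.
rewrite /cell_measure (reindex_inj s_inj)/= -sumEFin; apply: lee_sum => i _.
case: (s_spans i) => _ _ up; case: ltnP => ik.
  rewrite (_ : _ `&` _ = set0) ?measure0 ?mule0//.
  rewrite -subset0 => y [/= xy /up]; rewrite /= in_itv/= => /andP[_ yt].
  by have := node_le t_lt ik kn; lra.
apply: (@le_trans _ _ ((pi (s i) / len D (s i))%:E * (len D (s i))%:E)%E).
  apply: lee_wpmul2l.
    by rewrite lee_fin divr_ge0 ?distr_ge0// ltW// len_gt0.
  by rewrite fineK ?cell_fin//; apply: le_outer_measure => y [].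
by rewrite -EFinM divfK// gt_eqF// len_gt0.
Qed.

(** The second bound combines [tail_le] with [right_branch_le] and makes the tail small; the third
    turns the remaining mass near 0 into a lower bound for the first cell. *)
Lemma origin_tail x : 0 < x < 1 -> (forall i, len D i <= x / 2) ->
  exists e, [/\ (cell_measure pi [set y | (x < y)%R] <= e%:E)%E,
    e * (x / 4) `^ (1 + alpha) * a <= pi (origin_cell D) * a `^ alpha &
    (1 - e) * a <= pi (origin_cell D) * x].
Proof.
move=> /andP[x0 x1] lenx.
(* The last node up to [x]. It is at least [x / 2] because cells are that short, and [tail_le]
   halves it again, whence [x / 4]. *)
have [j /andP[jx xj]] := node_find t_0 t_1 (ltW x0) x1.
have xt : x / 2 <= t j.
  by have := lenx (s j); rewrite (spans_len (s_spans j)); lra.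
have j0 : (0 < j)%N.
  by rewrite lt0n; apply/eqP => j0; move: xt; rewrite j0 t_0; lra.
have jn := ltnW (ltn_ord j).
have aj : a <= t j by rewrite aE (node_le t_lt).
have tj1 : t j <= 1 by case/andP: (node_itv t_0 t_1 t_lt jn).
have a_balance : balance alpha F a by rewrite aE; exact: F_balance.
exists (1 - F (t j)); split; first exact: cell_measure_tail_le.
- have := @tail_le _ _ _ alpha_ge0 F_concave F_le F1 (t j) ltac:(lra) tj1 (F_balance jn).
  have := right_branch_le alpha_ge0 F_concave F_le F0 F1 a_gt0 a_le1 a_balance F_linear.
  rewrite -Fa => h1 h2; apply: le_trans h1; rewrite ler_pM2r//.
  apply: le_trans h2; apply: ler_wpM2l.
    by rewrite subr_ge0 -[leRHS]F1 F_le.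
  have a0 := alpha_ge0.
  by apply: ge0_ler_powR; rewrite ?nnegrE; lra.
- have := head_le F_concave F0 a_gt0 aj tj1; rewrite -Fa => h.
  have -> : 1 - (1 - F (t j)) = F (t j) by ring.
  apply: le_trans h _; apply: ler_wpM2l => //.
  by rewrite Fa distr_ge0.
Qed.

End PartitionChain.

(** * The same estimates, freed from the choice of a sorting *)

Section PartitionEstimates.
Context {R : realType}.
Variables (alpha : R) (D : cell_partition R).
Hypothesis alpha_ge0 : 0 <= alpha.
Local Notation pi := (invariant_distr (trans_mx (Tmap alpha) D)).
Local Notation o := (origin_cell D).

Lemma trans_mx_uniquely_ergodic : uniquely_ergodic (trans_mx (Tmap alpha) D).
Proof.
have [s [t [si t0 t1 tl sp]]] := cell_sorting D.
exact: (partition_uniquely_ergodic alpha_ge0 si t0 t1 tl sp).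
Qed.

Lemma origin_cell_mass_le :
  pi o * (len D o / 2) `^ (1 + alpha) * descent alpha 1 <= len D o ^+ 2.
Proof.
have [s [t [si t0 t1 tl sp]]] := cell_sorting D.
exact: (origin_mass_le alpha_ge0 si t0 t1 tl sp).
Qed.

Lemma origin_cell_tail x : 0 < x < 1 -> (forall i, len D i <= x / 2) ->
  exists e, [/\ (cell_measure pi [set y | (x < y)%R] <= e%:E)%E,
    e * (x / 4) `^ (1 + alpha) * len D o <= pi o * len D o `^ alpha &
    (1 - e) * len D o <= pi o * x].
Proof.
have [s [t [si t0 t1 tl sp]]] := cell_sorting D.
exact: (origin_tail alpha_ge0 si t0 t1 tl sp).
Qed.

End PartitionEstimates.

(** * Integrals against a law concentrated near the origin *)

Section DistanceToDirac.
Context {R : realType}.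
Variable mu : probability (measurableTypeR R) R.
Hypothesis mu01 : mu [set` `[0%R, 1%R]] = 1%E.

Local Open Scope ereal_scope.

(** On [0, 1] the function [|f - f 0|] is at most [e] plus [B] times the indicator of the points
    beyond [x]. *)
Lemma integral_near_dirac (f : R -> R) (x e B : R) :
  {within [set` `[0%R, 1%R]], continuous f} -> (0 <= e)%R -> (0 <= B)%R ->
  (forall y, 0 <= y <= 1 -> `|f y - f 0| <= B)%R ->
  (forall y, 0 <= y <= 1 -> y <= x -> `|f y - f 0| <= e)%R ->
  `|\int[mu]_(y in [set` `[0%R, 1%R]]) (f y)%:E - (f 0%R)%:E| <=
  e%:E + B%:E * mu [set y | (x < y)%R].
Proof.
move=> cf e0 B0 fB fe.
set I := [set` `[0%R, 1%R]] : set (measurableTypeR R).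
have mI : measurable I by exact: measurable_itv.
have mf : measurable_fun I f by exact: subspace_continuous_measurable_fun.
have muI1 : mu I = 1 by exact: mu01.
have intcst r : \int[mu]_(y in I) r = r by rewrite -[RHS]mule1 -muI1; exact: integral_cst.
have muI : mu I < +oo by rewrite muI1 ltry.
have intf : mu.-integrable I (EFin \o f).
  apply: measurable_bounded_integrable => //.
  exists (B + `|f 0%R|)%R; split; first exact: num_real.
  move=> M BM y; rewrite /I /= in_itv /= => /fB h.
  apply: le_trans (ltW BM); rewrite -[in leLHS](subrK (f 0%R) (f y)).
  by apply: le_trans (ler_normD _ _) _; rewrite lerD2r.
have intc : mu.-integrable I (EFin \o cst (f 0%R)).
  exact: finite_measure_integrable_cst.
have mfc : measurable_fun I (f \- cst (f 0%R))%R by exact: measurable_funB.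
have mA : measurable ([set` `]x, +oo[] : set (measurableTypeR R)) by exact: measurable_itv.
have -> : [set y | (x < y)%R] = [set` `]x, +oo[].
  by apply/seteqP; split => y /=; rewrite in_itv/= andbT.
have -> : (f 0%R)%:E = \int[mu]_(y in I) (cst (f 0%R) y)%:E.
  by rewrite -[LHS]intcst.
rewrite -integralB_EFin//.
apply: le_trans (le_abse_integral _ _ _) _ => //.
  exact/measurable_EFinP.
apply: (@le_trans _ _ (\int[mu]_(y in I) (e%:E + B%:E * (\1_([set` `]x, +oo[]) y)%:E))).
  apply: ge0_le_integral => //.
  - by apply: measurableT_comp => //; exact/measurable_EFinP.
  - apply/measurable_EFinP/measurable_funD => //.
    exact/measurable_funM.
  - move=> y; rewrite /I/= in_itv/= => y01.
    rewrite -EFinM -EFinD lee_fin indicE.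
    have [xy|yx] := ltP x y.
      by rewrite mem_set/= ?in_itv/= ?xy// mulr1 (le_trans (fB y y01))// lerDr.
    by rewrite memNset/= ?in_itv/= ?andbT ?ltNge ?yx// mulr0 addr0 fe.
rewrite ge0_integralD//; last 2 first.
- by move=> y _; rewrite -EFinM lee_fin mulr_ge0.
- by apply/measurable_EFinP/measurable_funM.
rewrite intcst; apply: leeD2l.
rewrite ge0_integralZl_EFin//.
  rewrite integral_indic//; apply: lee_wpmul2l; rewrite ?lee_fin//.
  by apply: le_measure; rewrite ?inE//; exact: measurableI.
exact/measurable_EFinP.
Qed.

End DistanceToDirac.

(** * Passage from the cell at the origin to the diameter, and the limits *)

Section Scaling.
Context {R : realType}.
Implicit Types (D : cell_partition R) (alpha K : R).

Lemma powR_small (p y : R) : 0 < p -> 0 < y ->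
  exists d, 0 < d /\ forall x, 0 <= x -> x <= d -> x `^ p <= y.
Proof.
move=> p0 y0; exists (y `^ p^-1); split; first exact: powR_gt0.
move=> x x0 xd; have -> : y = (y `^ p^-1) `^ p.
  by rewrite -powRrM mulVf ?gt_eqF// powRr1// ltW.
by apply: ge0_ler_powR; rewrite ?nnegrE ?powR_ge0// ltW.
Qed.

Lemma len_le_diam D i : len D i <= diam D.
Proof. exact: le_bigmax. Qed.

Lemma diam_le K D i : balanced K D -> diam D <= K * len D i.
Proof.
move=> bD; have l0 := len_gt0 i.
have h j : len D j <= K * len D i by rewrite -ler_pdivrMr.
by apply: bigmax_le => // ; apply: le_trans (h i); exact: ltW.
Qed.

Lemma balanced_gt0 K D : balanced K D -> 0 < K.
Proof.
move=> bD; have := bD ord0 ord0.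
by rewrite divff ?gt_eqF ?len_gt0//; apply: lt_le_trans; exact: ltr01.
Qed.

Lemma cell_measure01 D (pi : distr R (ncells D).+1) :
  cell_measure pi [set` `[0, 1]] = 1%E.
Proof.
rewrite -(probability_setT (cell_measure pi)) /= /cell_measure.
apply: eq_bigr => i _; rewrite setTI setIidr//; exact: cell_sub01.
Qed.

(** With [a] the length of the cell at the origin and [d] the diameter, [a <= d <= K * a]; so [a]
    may be replaced by [d] on the right of [origin_cell_mass_le] and by [d / K] on the left. *)
Lemma origin_mass_diam alpha K D : 0 <= alpha -> balanced K D ->
  invariant_distr (trans_mx (Tmap alpha) D) (origin_cell D) <=
  (2 * K) `^ (1 + alpha) / descent alpha 1 * diam D `^ (1 - alpha).
Proof.
move=> a0 bD; have K0 := balanced_gt0 bD.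
have := origin_cell_mass_le D a0.
have := diam_le (origin_cell D) bD; have := len_le_diam (origin_cell D).
have := len_gt0 (origin_cell D).
set m := (X in X * _ * _ <= _); have m0 : 0 <= m by exact: distr_ge0.
move: (len D _) (diam D) => a d pa ad da h.
have d0 : 0 < d by lra.
have c0 : 0 < descent alpha 1.
  by rewrite -[ltLHS](descent0 a0); apply: descent_lt => //; lra.
have p0 : 0 < d `^ (1 + alpha) by exact: powR_gt0.
have p0' : 0 < (2 * K) `^ (1 + alpha) by apply: powR_gt0; lra.
have e2 : d ^+ 2 = d `^ (1 - alpha) * d `^ (1 + alpha).
  rewrite -powRD ?(gt_eqF d0) ?implybT//.
  by rewrite (_ : 1 - alpha + (1 + alpha) = 2%:R) ?powR_mulrn ?ltW//; ring.
have e1 : d `^ (1 + alpha) = (d / (2 * K)) `^ (1 + alpha) * (2 * K) `^ (1 + alpha).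
  by rewrite -powRM ?divr_ge0 ?divfK//; lra.
have h1 : (d / (2 * K)) `^ (1 + alpha) <= (a / 2) `^ (1 + alpha).
  have u : d / (2 * K) <= a / 2.
    by rewrite ler_pdivrMr; lra.
  have u0 : 0 <= d / (2 * K) by rewrite divr_ge0; lra.
  by apply: ge0_ler_powR; rewrite ?nnegrE; lra.
have h2 : m * (d / (2 * K)) `^ (1 + alpha) * descent alpha 1 <= d ^+ 2.
  apply: (@le_trans _ _ (a ^+ 2)); last by rewrite !expr2 ler_pM//; lra.
  apply: le_trans h; rewrite ler_pM2r//; exact: ler_wpM2l.
rewrite mulrAC ler_pdivlMr// -(ler_pM2r p0).
rewrite -[leRHS]mulrA -e2 e1 (mulrC _ (d ^+ 2)).
have -> : m * descent alpha 1 * ((d / (2 * K)) `^ (1 + alpha) * (2 * K) `^ (1 + alpha)) =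
  m * (d / (2 * K)) `^ (1 + alpha) * descent alpha 1 * (2 * K) `^ (1 + alpha) by ring.
by rewrite ler_pM2r.
Qed.

Lemma mass_origin_cell alpha D :
  fine (invariant_measure (Tmap alpha) D [set` cell D (origin_cell D)]) =
  invariant_distr (trans_mx (Tmap alpha) D) (origin_cell D).
Proof. by rewrite /invariant_measure/= cell_measure_cell. Qed.

Lemma origin_density_cvg alpha K : 0 < alpha ->
  invariant_distr (trans_mx (Tmap alpha) D) (origin_cell D) / diam D
    @[D --> fine_partitions K] --> +oo.
Proof.
move=> a0; apply/cvgryPge => A.
pose M := Num.max A 1; pose L := Num.max K 1.
have AM : A <= M by rewrite le_max lexx.
have M1 : 1 <= M by rewrite le_max lexx orbT.
have KL : K <= L by rewrite le_max lexx.
have L1 : 1 <= L by rewrite le_max lexx orbT.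
have ML1 : 1 <= M * L by rewrite -[leLHS]mulr1 ler_pM.
(* The two tail bounds will add up to [a <= 2 * x * m], and the diameter is at most [L * a]; this
   [x] gives [M * L * (2 * x) = 1]. *)
pose x := (2 * (M * L))^-1.
have x0 : 0 < x by rewrite invr_gt0; lra.
have x1 : x < 1 by rewrite invf_lt1; lra.
pose E := (x / 4) `^ (1 + alpha).
have E0 : 0 < E by rewrite powR_gt0//; lra.
(* With [a^alpha <= x * E] the second bound of [origin_cell_tail] becomes [e * a <= m * x], matching
   the third. *)
have [d [d0 dP]] := powR_small a0 (mulr_gt0 x0 E0).
exists (Num.min d (x / 2)) => /=; first by rewrite lt_min d0 divr_gt0.
move=> D [bD]; rewrite lt_min => /andP[Dd Dx].
have h i : len D i <= x / 2 by apply: le_trans (len_le_diam i) (ltW Dx).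
have [|e [_ +]] := @origin_cell_tail _ alpha D (ltW a0) x _ h; first by rewrite x0.
have := diam_le (origin_cell D) bD; have := len_le_diam (origin_cell D).
have := len_gt0 (origin_cell D).
set m := invariant_distr _ _; have m0 : 0 <= m by exact: distr_ge0.
move: (len D _) (diam D) Dd Dx => a r Dd Dx pa ar rKa h1 h2.
rewrite -/E in h1.
have aa : a `^ alpha <= x * E by apply: dP; lra.
have h3 : e * a <= m * x.
  rewrite -(ler_pM2r E0) mulrAC; apply: le_trans h1 _.
  by rewrite -mulrA; exact: ler_wpM2l.
have am : a <= m * (2 * x) by lra.
rewrite ler_pdivlMr; last by lra.
have rLa : r <= L * a by apply: le_trans rKa _; rewrite ler_pM2r.
have e1 : M * L * (2 * x) = 1.
  by rewrite mulrA [M * L * 2]mulrC divff// gt_eqF//; lra.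
apply: (@le_trans _ _ (M * (L * (m * (2 * x))))).
  have r0 : 0 <= r by lra.
  apply: (@le_trans _ _ (M * r)); first exact: ler_wpM2r.
  apply: ler_wpM2l; first by lra.
  by apply: le_trans rLa _; apply: ler_wpM2l => //; lra.
have -> : M * (L * (m * (2 * x))) = M * L * (2 * x) * m by ring.
by rewrite e1 mul1r.
Qed.

(** The first cell has mass at most 1, so the mass beyond a fixed [x] is at most [a^(alpha - 1)] up
    to a factor depending on [x] and [alpha]; this tends to 0. *)
Lemma invariant_measure_weak_cvg alpha K : 1 < alpha ->
  weak_cvg (fine_partitions K) (invariant_measure (Tmap alpha))
    (dirac (0 : measurableTypeR R)).
Proof.
move=> a1 f cf.
have a0 : 0 <= alpha by lra.
have mf : measurable_fun ([set` `[0, 1]] : set (measurableTypeR R)) f.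
  by apply: subspace_continuous_measurable_fun => //; exact: measurable_itv.
have -> : (\int[dirac (0%R : measurableTypeR R)]_(x in [set` `[0%R, 1%R]]) (f x)%:E =
    (f 0%R)%:E)%E.
  rewrite integral_dirac//; last exact/measurable_EFinP.
  by rewrite diracE mem_set ?mul1e//= in_itv/= lexx ler01.
have cf0 : {within [set` `[(0 : R), 1]], continuous (fun y => `|f y - f 0|)}.
  move=> y; apply: cvg_norm; apply: cvgB; [exact: cf|exact: cvg_cst].
have [z _ zB] := EVT_max ler01 cf0.
set B := `|f z - f 0| in zB; have B0 : 0 <= B by exact: normr_ge0.
suff key e : 0 < e -> \forall D \near fine_partitions K,
    (`|\int[invariant_measure (Tmap alpha) D]_(x in [set` `[0%R, 1%R]]) (f x)%:E
       - (f 0%R)%:E| <= e%:E)%E.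
  (* Convergence in the extended reals also asks for integrals that are eventually finite, which the
     bound with [e = 1] provides. *)
  apply/fine_cvgP; split.
    apply: filterS (key 1 ltr01) => D.
    by case: (\int[_]_(_ in _) _)%E.
  apply/cvgrPdist_le => e e0; apply: filterS (key e e0) => D /=.
  by case: (\int[_]_(_ in _) _)%E => //= r; rewrite lee_fin distrC.
move=> e0.
have e20 : 0 < e / 2 by rewrite divr_gt0.
have [x [x01 fx]] : exists x, 0 < x < 1 /\
    forall y, 0 <= y <= 1 -> y <= x -> `|f y - f 0| <= e / 2.
  have : f @ within [set` `[(0 : R), 1]] (nbhs 0) --> f 0.
    by move/subspace_continuousP : cf; apply; rewrite /= in_itv/= lexx ler01.
  move/cvgrPdist_le => /(_ _ e20); rewrite near_withinE => -[d /= d0 dP].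
  exists (Num.min (d / 2) 2^-1); split.
    by rewrite lt_min divr_gt0//= invr_gt0 ltr0n/= gt_min invf_lt1 ?ltr1n ?orbT.
  move=> y y01; rewrite le_min => /andP[yd _]; rewrite distrC; apply: dP => //=.
  rewrite /ball_/= sub0r normrN ger0_norm; [lra|by case/andP: y01].
pose E := (x / 4) `^ (1 + alpha).
have x0 : 0 < x by case/andP: x01.
have E0 : 0 < E by rewrite powR_gt0// divr_gt0.
have am1 : 0 < alpha - 1 by lra.
have B1 : 0 < B + 1 by lra.
(* Dividing by [B + 1] includes the case of a constant [f], where [B = 0]. *)
have k0 : 0 < e / 2 / (B + 1) * E by rewrite mulr_gt0// divr_gt0.
have [d [d0 dP]] := powR_small am1 k0.
exists (Num.min d (x / 2)) => /=; first by rewrite lt_min d0 divr_gt0.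
move=> D [bD]; rewrite lt_min => /andP[Dd Dx].
have h i : len D i <= x / 2 by apply: le_trans (len_le_diam i) (ltW Dx).
have [t [tail + _]] := origin_cell_tail a0 x01 h.
have := len_le_diam (origin_cell D); have := len_gt0 (origin_cell D).
set m := invariant_distr _ _.
have m1 : m <= 1.
  rewrite -[leRHS](distr_sum (invariant_distr (trans_mx (Tmap alpha) D))).
  by rewrite (bigD1 (origin_cell D))//= lerDl sumr_ge0// => i _; exact: distr_ge0.
move: (len D _) => a pa ad; rewrite -/E => h1.
have ta : t <= e / 2 / (B + 1).
  rewrite -(ler_pM2r E0) -(ler_pM2r pa); apply: le_trans h1 _.
  have -> : a `^ alpha = a `^ (alpha - 1) * a.
    by rewrite mulrC -(powR1D (ltW am1) (ltW pa)) addrC subrK.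
  have : a `^ (alpha - 1) <= e / 2 / (B + 1) * E by apply: dP; lra.
  move=> u; apply: (@le_trans _ _ (1 * (a `^ (alpha - 1) * a))).
    by apply: ler_wpM2r => //; rewrite mulr_ge0 ?powR_ge0// ltW.
  by rewrite mul1r; apply: ler_wpM2r => //; exact: ltW.
have := @integral_near_dirac _ (invariant_measure (Tmap alpha) D) _ f x (e / 2) B cf (ltW e20) B0.
move=> /(_ (cell_measure01 _)) /(_ _ fx) near_dirac.
apply: le_trans (near_dirac _) _.
  by move=> y y01; apply: zB; rewrite in_itv.
apply: (@le_trans _ _ ((e / 2)%:E + B%:E * t%:E)%E).
  by apply: leeD2l; apply: lee_wpmul2l => //; rewrite lee_fin.
rewrite -EFinM -EFinD lee_fin.
have : B * t <= e / 2.
  apply: (@le_trans _ _ (B * (e / 2 / (B + 1)))); first exact: ler_wpM2l.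
  rewrite mulrA ler_pdivrMr// mulrC; apply: ler_wpM2l; lra.
lra.
Qed.

End Scaling.

Theorem theorem1 (R : realType) (alpha K : R) (halpha : 0 <= alpha) :
  let T := Tmap alpha in
  let mu := fun D : cell_partition R => invariant_measure T D in
  let mu1 := fun D : cell_partition R => fine (mu D [set` cell D (origin_cell D)]) in
  exists delta0 : R, 0 < delta0 /\
    (forall D : cell_partition R, balanced K D -> diam D < delta0 ->
       uniquely_ergodic (trans_mx T D)) /\
    (exists C : R, forall D : cell_partition R, balanced K D -> diam D < delta0 ->
       mu1 D <= C * diam D `^ (1 - alpha)) /\
    (0 < alpha ->
       mu1 D / diam D @[D --> fine_partitions K] --> +oo) /\
    (1 < alpha ->
       weak_cvg (fine_partitions K) mu (dirac (0 : measurableTypeR R))).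
Proof.
move=> T mu mu1.
have mu1E D : mu1 D = invariant_distr (trans_mx T D) (origin_cell D).
  exact: mass_origin_cell.
exists 1; split; first exact: ltr01.
split; first by move=> D _ _; exact: trans_mx_uniquely_ergodic.
split.
  exists ((2 * K) `^ (1 + alpha) / descent alpha 1) => D bD _.
  by rewrite mu1E; exact: origin_mass_diam.
split=> a0; last exact: invariant_measure_weak_cvg.
by under eq_fun do rewrite mu1E; exact: origin_density_cvg.
Qed.
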